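(* Let $l\ge 1$ be an integer and let $\epsilon_{\mathrm b}\in\mathbb{C}\setminus(-\infty,0]$ with $\operatorname{Im}\epsilon_{\mathrm b}\ge 0$ be fixed. Let $\epsilon_{\mathrm p,l}(k_0a)$ be the plasmonic multipole singularity of the homogeneous sphere, i.e. the unique zero $\epsilon$ of $f_l(\epsilon,k_0a)$ (defined in the context) with $\epsilon_{\mathrm p,l}(k_0a)\to-\frac{l+1}{l}\epsilon_{\mathrm b}$ as $k_0a\to0$. Then, as $k_0a\to 0$, $$\epsilon_{\mathrm p,l}(k_0a)=-\frac{l+1}{l}\epsilon_{\mathrm b}+(k_0a)^2F_l(k_0a,\epsilon_{\mathrm b})-\mathrm i\,(k_0a)^{2l+1}\epsilon_{\mathrm b}^{l+1}\sqrt{\epsilon_{\mathrm b}}\,\frac{l+1}{l^2}\frac{1}{((2l-1)!!)^2}+\mathcal{O}\{(k_0a)^{2l+2}\},$$ where $F_l(k_0a,\epsilon_{\mathrm b})$ is a polynomial in $(k_0a,\epsilon_{\mathrm b})$ with real coefficients, whose terms have even order in $k_0a$ ranging from $0$ up to $2l-2$. Explicitly, for the dipole ($l=1$), $$\epsilon_{\mathrm p,1}(k_0a)=-2\epsilon_{\mathrm b}-\frac{12}{5}\epsilon_{\mathrm b}^2(k_0a)^2-2\mathrm i\,\epsilon_{\mathrm b}^2\sqrt{\epsilon_{\mathrm b}}\,(k_0a)^3+\mathcal{O}\{(k_0a)^4\},$$ and for the quadrupole ($l=2$), $$\epsilon_{\mathrm p,2}(k_0a)=-\frac32\epsilon_{\mathrm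 b}-\frac{5}{14}\epsilon_{\mathrm b}^2(k_0a)^2-\frac{65}{392}\epsilon_{\mathrm b}^3(k_0a)^4-\frac{\mathrm i}{12}\epsilon_{\mathrm b}^3\sqrt{\epsilon_{\mathrm b}}\,(k_0a)^5+\mathcal{O}\{(k_0a)^6\}.$$
   Context: Square roots are principal. $\psi_l(z)=z\,\mathrm{j}_l(z)$ and $\xi_l(z)=z\,\mathrm{h}^{(1)}_l(z)$ are the Riccati-Bessel functions ($\mathrm{j}_l$ spherical Bessel, $\mathrm{h}_l^{(1)}$ spherical Hankel function of the first kind), primes denote derivatives with respect to the argument. With $x=z\sqrt{\epsilon}$ and $x_{\mathrm b}=z\sqrt{\epsilon_{\mathrm b}}$ define $$f_l(\epsilon,z)=\frac{2l+1}{l}\left(\mathrm i\,x_{\mathrm b}^{l}\,\xi_l(x_{\mathrm b})\;x^{-l}\psi_l'(x)\,\epsilon_{\mathrm b}-\mathrm i\,x^{-l-1}\psi_l(x)\;x_{\mathrm b}^{l+1}\xi_l'(x_{\mathrm b})\,\epsilon\right),$$ which extends to an analytic function of $(\epsilon,z)\in\mathbb{C}^2$. For $z=k_0a$ ($k_0$ vacuum wavenumber, $a$ radius) it is the denominator of the electric Mie coefficient of order $l$ of a homogeneous sphere of permittivity $\epsilon$ in a background of permittivity $\epsilon_{\mathrm b}$. Near $(\epsilon,z)=(-\frac{l+1}{l}\epsilon_{\mathrm b},0)$ the zero set of $f_l$ is the graph of a unique analytic function $z\mapsto\epsilon_{\mathrm p,l}(z)$ with $\epsilon_{\mathrm p,l}(0)=-\frac{l+1}{l}\epsilon_{\mathrm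 b}$. *)

(* Defs.v *)
From Stdlib Require Import Reals.
From Coquelicot Require Import Coquelicot.

Open Scope R_scope.

(** * Elementary complex functions *)

(* Principal branch, Arg in (-PI, PI]: Re (Csqrt z) >= 0, and
   Csqrt (-a) = i sqrt a for a > 0. *)
Definition Csqrt (z : C) : C :=
  (sqrt ((Cmod z + Re z) / 2),
   (if Rle_dec 0 (Im z) then 1 else -1) * sqrt ((Cmod z - Re z) / 2)).

Definition Cexp (z : C) : C :=
  (exp (Re z) * cos (Im z), exp (Re z) * sin (Im z)).

Definition Csin (z : C) : C := ((Cexp (Ci * z) - Cexp (- (Ci * z))) / (2 * Ci))%C.

Definition Ccos (z : C) : C := ((Cexp (Ci * z) + Cexp (- (Ci * z))) / 2)%C.

(** * Spherical Bessel functions of integer order, on [z <> 0]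

    Rayleigh's formulas:
    j_l(z) =   (-z)^l ((1/z) d/dz)^l (sin z / z),
    y_l(z) = - (-z)^l ((1/z) d/dz)^l (cos z / z),
    and h^(1)_l = j_l + i y_l.  At [z = 0] the values are meaningless. *)

Definition rayleigh_op (g : C -> C) : C -> C := fun z => (C_derive g z / z)%C.

Definition sph_j (l : nat) (z : C) : C :=
  ((- z) ^ l * Nat.iter l rayleigh_op (fun w => Csin w / w) z)%C.

Definition sph_y (l : nat) (z : C) : C :=
  (- ((- z) ^ l * Nat.iter l rayleigh_op (fun w => Ccos w / w) z))%C.

Definition sph_h1 (l : nat) (z : C) : C := (sph_j l z + Ci * sph_y l z)%C.

Definition psi (l : nat) (z : C) : C := (z * sph_j l z)%C.

Definition xi (l : nat) (z : C) : C := (z * sph_h1 l z)%C.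

(** * The Mie denominator and the plasmonic singularity *)

(* The closed formula for f_l, valid for [z <> 0], [eps <> 0], [epsb <> 0].  The
   singularities at [z = 0] and at [eps = 0] are removable; the values of the
   analytic extension there are not needed below, where [z <> 0] and [eps] is
   close to a nonzero number. *)
Definition mie_f (l : nat) (epsb eps z : C) : C :=
  let x := (z * Csqrt eps)%C in
  let xb := (z * Csqrt epsb)%C in
  (RtoC ((2 * INR l + 1) / INR l) *
   (Ci * xb ^ l * xi l xb * (/ x ^ l * C_derive (psi l) x) * epsb
    - Ci * (/ x ^ (l + 1) * psi l x) * (xb ^ (l + 1) * C_derive (xi l) xb) * eps))%C.

Definition static_resonance (l : nat) (epsb : C) : C :=
  (- (RtoC ((INR l + 1) / INR l) * epsb))%C.

(* [ep z] is a zero of [f_l(., z)] for all small complex [z <> 0], and it tends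
   to the static value as [z -> 0].  By local uniqueness of the zero, this
   determines [ep] on a punctured neighbourhood of [0]. *)
Definition plasmonic_singularity (l : nat) (epsb : C) (ep : C -> C) : Prop :=
  filterlim ep (locally' (RtoC 0)) (locally (static_resonance l epsb)) /\
  locally' (RtoC 0) (fun z : C => mie_f l epsb (ep z) z = RtoC 0).

(** * Vocabulary of the expansion *)

(* [n!!], with [0!! = 1!! = 1]. *)
Fixpoint double_fact (n : nat) : nat :=
  match n with
  | S (S m as p) => S p * double_fact m
  | _ => 1
  end%nat.

(* [F z e] is a polynomial in [(z, e)] with real coefficients, all of whose
   terms have even order at most [d] in [z]. *)
Definition real_poly_even (d : nat) (F : C -> C -> C) : Prop :=
  exists (N : nat) (c : nat -> nat -> R),
    (forall j n : nat, Nat.Odd j -> c j n = 0) /\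
    (forall z e : C,
       F z e = sum_n (fun j : nat =>
                 sum_n (fun n : nat => (RtoC (c j n) * z ^ j * e ^ n)%C) N) d).

(* [g z = h z + O(z^n)] as [z -> 0], [z <> 0]. *)
Definition eq_mod_bigO (g h : C -> C) (n : nat) : Prop :=
  exists M : R, locally' (RtoC 0) (fun z : C => Cmod (g z - h z)%C <= M * Cmod z ^ n).

(* Main.v *)
Require Import Defs.
From Stdlib Require Import Reals Lra Lia List Factorial.
From Coquelicot Require Import Coquelicot.
Import ListNotations.

Open Scope R_scope.

(** With [eta = ep / epsb] and [u = xb^2 = epsb z^2] we have [x^2 = eta u], and the equation
    [f_l = 0] only involves [eta], [u] and [s = xb^(2l+1)]: up to [O(z^(2l+2))] it reads
    [A2(eta u) (B1(u) - i s A1(u)) = eta A1(eta u) (B2(u) - i s A2(u))], where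
    [psi_l(x) = x^(l+1) A1(x^2)], [psi_l'(x) = x^l A2(x^2)], [x y_l(x) = x^(-l) B1(x^2)] and
    [(x y_l)'(x) = x^(-l-1) B2(x^2)] have real Taylor coefficients.  Without [s] it has a formal
    solution [P(u)] with real coefficients; the term linear in [s] contributes a multiple of
    [i s].  The left side minus the right side is, up to a relative error [O(z)], a nonzero
    constant times the variation of [eta], so an approximate solution with residue
    [O(z^(2l+2))] agrees with [eta] up to [O(z^(2l+2))].

    No infinite series are needed: Taylor polynomials of sine and cosine with remainders whose
    derivatives are again remainders are stable under Rayleigh's operator. *)

(** * Complex differentiation *)

(** For positive [epsb] the static value lies on the branch cut of the principal root, and [ep] is
    an arbitrary function with that limit, so [Csqrt (ep z)] may jump between the two roots. Hence
    only the square of the root is used: dividing psi_l(x) and psi_l'(x) by their leading powers of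
    x leaves polynomials in x^2 = eta u and remainders that are estimated through the size of x
    alone. The accuracy 2l+2 keeps the analysis linear in s: since s has order 2l+1, its products
    with u and with itself fall into the error, and only the constant terms of the series enter the
    coefficient of i s. *)

Definition is_Cderive (f : C -> C) (z l : C) : Prop :=
  is_derive (K := C_AbsRing) (V := AbsRing_NormedModule C_AbsRing) f z l.

(** [is_C_derive_unique] is stated for another normed module structure on the complex numbers;
    operations and norm agree up to conversion, so the fields transfer one by one. *)
Lemma C_derive_eq (f : C -> C) (z l : C) : is_Cderive f z l -> C_derive f z = l.
Proof.
  intros [[p s b] H]. apply is_C_derive_unique.
  split; [split; [exact p | exact s | exact b] | exact H].
Qed.

Lemma is_Cderive_eps (f : C -> C) (z l : C) :
  is_Cderive f z l <->
  forall e : R, 0 < e -> exists d : R, 0 < d /\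
    forall h : C, Cmod h < d ->
      Cmod (f (z + h) - f z - l * h)%C <= e * Cmod h.
Proof.
  split.
  - intros [_ H] e He.
    destruct (H z (fun P HP => HP) (mkposreal e He)) as [d K].
    exists d. split. apply cond_pos. intros h Hh.
    specialize (K (z + h)%C).
    unfold ball in K; simpl in K; unfold AbsRing_ball in K; simpl in K.
    unfold minus, plus, opp, norm, scal in K; simpl in K.
    unfold abs, mult in K; simpl in K.
    replace (z + h + - z)%C with h in K by ring.
    specialize (K Hh).
    replace (f (z + h) - f z - l * h)%C with (f (z + h) + - f z + - (h * l))%C by ring.
    exact K.
  - intros H. split. apply is_linear_scal_l.
    intros x Hx e.
    assert (E : z = x)
      by apply (is_filter_lim_locally_unique (K := C_AbsRing)
                  (V := AbsRing_NormedModule C_AbsRing) z x Hx).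
    subst x.
    destruct (H e (cond_pos e)) as (d & Hd & K). exists (mkposreal d Hd).
    intros y B. unfold ball in B; simpl in B. unfold AbsRing_ball in B. simpl in B.
    specialize (K _ B). unfold minus, plus, opp, norm, scal in *; simpl in *.
    unfold abs; simpl.
    replace (z + (y + - z))%C with y in K by ring. unfold mult; simpl.
    replace (f y + - f z + - ((y + - z) * l))%C with (f y - f z - l * (y + - z))%C by ring.
    exact K.
Qed.

(** The Bessel functions are controlled only away from the origin; the disc of radius [Cmod z] about
    [z] misses it. *)
Lemma is_Cderive_ext (f g : C -> C) (z l : C) :
  z <> 0%C -> (forall w : C, w <> 0%C -> f w = g w) ->
  is_Cderive f z l -> is_Cderive g z l.
Proof.
  intros H K. apply is_derive_ext_loc.
  exists (mkposreal _ (proj1 (Cmod_gt_0 z) H)).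
  intros y B. apply K. intros ->. unfold ball in B; simpl in B.
  unfold AbsRing_ball in B. simpl in B.
  unfold minus, plus, opp in B. simpl in B. rewrite Cplus_0_l, Cmod_opp in B.
  revert B. apply Rlt_irrefl.
Qed.

Lemma is_Cderive_eq_val (f : C -> C) (z a b : C) :
  a = b -> is_Cderive f z a -> is_Cderive f z b.
Proof. now intros ->. Qed.

Lemma is_Cderive_eq_fun (f g : C -> C) (z l : C) :
  (forall w : C, f w = g w) -> is_Cderive f z l -> is_Cderive g z l.
Proof. exact (is_derive_ext (K := C_AbsRing) (V := AbsRing_NormedModule C_AbsRing) f g z l). Qed.

Lemma is_Cderive_mult (f g : C -> C) (z a b : C) :
  is_Cderive f z a -> is_Cderive g z b ->
  is_Cderive (fun w => f w * g w)%C z (a * g z + f z * b)%C.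
Proof. intros H K. exact (is_derive_mult (K := C_AbsRing) f g z a b H K Cmult_comm). Qed.

Lemma is_Cderive_plus (f g : C -> C) (z a b : C) :
  is_Cderive f z a -> is_Cderive g z b ->
  is_Cderive (fun w => f w + g w)%C z (a + b)%C.
Proof. exact (is_derive_plus (K := C_AbsRing) (V := AbsRing_NormedModule C_AbsRing) f g z a b). Qed.

Lemma is_Cderive_comp (f g : C -> C) (z a b : C) :
  is_Cderive f (g z) a -> is_Cderive g z b ->
  is_Cderive (fun w => f (g w)) z (b * a)%C.
Proof. exact (is_derive_comp (K := C_AbsRing) (V := AbsRing_NormedModule C_AbsRing) f g z a b). Qed.

Lemma is_Cderive_id (z : C) : is_Cderive (fun w => w) z 1%C.
Proof. exact (is_derive_id (K := C_AbsRing) z). Qed.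

Lemma is_Cderive_const (c z : C) : is_Cderive (fun _ => c) z 0%C.
Proof. exact (is_derive_const (K := C_AbsRing) (V := AbsRing_NormedModule C_AbsRing) c z). Qed.

Lemma is_Cderive_scal (c : C) (f : C -> C) (z a : C) :
  is_Cderive f z a -> is_Cderive (fun w => c * f w)%C z (c * a)%C.
Proof.
  intros H. replace (c * a)%C with (0 * f z + c * a)%C by ring.
  apply (is_Cderive_mult (fun _ => c)); [apply is_Cderive_const | exact H].
Qed.

Lemma is_Cderive_minus (f g : C -> C) (z a b : C) :
  is_Cderive f z a -> is_Cderive g z b ->
  is_Cderive (fun w => f w - g w)%C z (a - b)%C.
Proof.
  exact (is_derive_minus (K := C_AbsRing) (V := AbsRing_NormedModule C_AbsRing) f g z a b).
Qed.

Lemma is_Cderive_pow (n : nat) (z : C) :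
  is_Cderive (fun w => w ^ n)%C z (RtoC (INR n) * z ^ (n - 1))%C.
Proof.
  induction n as [|n IH].
  - simpl. rewrite Cmult_0_l. apply is_Cderive_const.
  - replace (RtoC (INR (S n)) * z ^ (S n - 1))%C
      with (1 * z ^ n + z * (RtoC (INR n) * z ^ (n - 1)))%C.
    apply (is_Cderive_mult (fun w => w) (fun w => w ^ n)%C); [apply is_Cderive_id | exact IH].
    rewrite S_INR, RtoC_plus. destruct n as [|n].
    simpl. ring.
    replace (S (S n) - 1)%nat with (S n) by lia. replace (S n - 1)%nat with n by lia.
    simpl Cpow. ring.
Qed.

Lemma is_Cderive_inv (z : C) : z <> 0%C -> is_Cderive Cinv z (- / (z * z))%C.
Proof.
  intros Hz. apply is_Cderive_eps. intros e He.
  assert (P : 0 < Cmod z) by now apply Cmod_gt_0.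
  (* The error of the linear approximation is h^2 / (z^2 (z + h)). The first bound keeps |z + h|
     above |z|/2, the second then makes 2|h|/|z|^3 at most [e]. *)
  exists (Rmin (Cmod z / 2) (e * Cmod z ^ 3 / 2)). split.
  { apply Rmin_pos. lra. apply Rmult_lt_0_compat; [|lra].
    apply Rmult_lt_0_compat; [lra | now apply pow_lt]. }
  intros h Hh.
  assert (H1 := Rlt_le_trans _ _ _ Hh (Rmin_l _ _)).
  assert (H2 := Rlt_le_trans _ _ _ Hh (Rmin_r _ _)).
  assert (T : Cmod z / 2 < Cmod (z + h)%C).
  { assert (T := Cmod_triangle (z + h) (- h)). rewrite Cmod_opp in T.
    replace (z + h + - h)%C with z in T by ring. lra. }
  assert (Hzh : (z + h)%C <> 0%C) by (apply Cmod_gt_0; lra).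
  replace (/ (z + h) - / z - - / (z * z) * h)%C with (h * h * (/ (z * z) * / (z + h)))%C
    by now field.
  rewrite !Cmod_mult, !Cmod_inv, Cmod_mult; trivial; try now apply Cmult_neq_0.
  assert (I : / Cmod (z + h)%C <= / (Cmod z / 2)) by (apply Rinv_le_contravar; lra).
  apply Rle_trans with (Cmod h * Cmod h * (/ (Cmod z * Cmod z) * / (Cmod z / 2))).
  - apply Rmult_le_compat_l. assert (X := Cmod_ge_0 h). nra.
    apply Rmult_le_compat_l; trivial. left. apply Rinv_0_lt_compat. nra.
  - replace (Cmod h * Cmod h * (/ (Cmod z * Cmod z) * / (Cmod z / 2)))
      with ((Cmod h * (2 / Cmod z ^ 3)) * Cmod h) by (field; lra).
    apply Rmult_le_compat_r. apply Cmod_ge_0.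
    replace e with ((e * Cmod z ^ 3 / 2) * (2 / Cmod z ^ 3)) by (field; lra).
    apply Rmult_le_compat_r; [|lra]. left.
    apply Rdiv_lt_0_compat; [lra | now apply pow_lt].
Qed.

(** * Mean value inequality *)

Lemma Rabs_le_Cmod_Im (z : C) : Rabs (Im z) <= Cmod z.
Proof. apply Rle_trans with (2 := Rmax_Cmod z). apply Rmax_r. Qed.

Lemma Cmod_le_Re_Im (z : C) : Cmod z <= Rabs (Re z) + Rabs (Im z).
Proof.
  replace z with (RtoC (Re z) + Ci * RtoC (Im z))%C at 1
    by (destruct z; unfold Ci, RtoC, Cplus, Cmult; simpl; f_equal; ring).
  apply Rle_trans with (1 := Cmod_triangle _ _).
  rewrite Cmod_mult, Cmod_Ci, !Cmod_R. lra.
Qed.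

(* Stated for a real functional, to be [Re] or [Im], as there is no intermediate point for complex values. *)
Lemma functional_mean_value (p : C -> R) (f f' : C -> C) (z : C) (M : R) :
  (forall a b, p (a - b)%C = p a - p b) ->
  (forall (r : R) a, p (RtoC r * a)%C = r * p a) ->
  (forall a, Rabs (p a) <= Cmod a) ->
  (forall w : C, Cmod w <= Cmod z -> is_Cderive f w (f' w) /\ Cmod (f' w) <= M) ->
  Rabs (p (f z) - p (f 0%C)) <= M * Cmod z.
Proof.
  intros pm ps pn H.
  assert (B : Rabs (p (f (RtoC 1 * z)%C) - p (f (RtoC 0 * z)%C)) <= (M * Cmod z) * Rabs (1 - 0)).
  { apply (bounded_variation (fun t => p (f (RtoC t * z)%C)) (fun t => p (f' (RtoC t * z) * z)%C)).
    intros t Ht. rewrite !Rminus_0_r, Rabs_R1 in Ht.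
    destruct (H (RtoC t * z)%C) as [D N].
    { rewrite Cmod_mult, Cmod_R. assert (X := Cmod_ge_0 z). nra. }
    split.
    - apply is_derive_Reals. intros e He.
      destruct (proj1 (is_Cderive_eps _ _ _) D (e / (2 * (1 + Cmod z)))) as (d & Hd & K).
      { apply Rdiv_lt_0_compat; trivial. assert (X := Cmod_ge_0 z). lra. }
      assert (Hd' : 0 < d / (1 + Cmod z))
        by (apply Rdiv_lt_0_compat; trivial; assert (X := Cmod_ge_0 z); lra).
      exists (mkposreal _ Hd'). intros h Hh Hhd. simpl in Hhd.
      assert (X := Cmod_ge_0 z).
      assert (Hp : 0 < Rabs h) by now apply Rabs_pos_lt.
      specialize (K (RtoC h * z)%C).
      assert (Hsm : Cmod (RtoC h * z)%C < d).
      { rewrite Cmod_mult, Cmod_R.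
        apply (Rmult_lt_compat_r (1 + Cmod z)) in Hhd; [|lra].
        unfold Rdiv in Hhd. rewrite Rmult_assoc, Rinv_l in Hhd by lra. nra. }
      specialize (K Hsm).
      replace (RtoC t * z + RtoC h * z)%C with (RtoC (t + h) * z)%C in K
        by (rewrite RtoC_plus; ring).
      rewrite Cmod_mult, Cmod_R in K.
      apply Rle_lt_trans with (e / 2); [|lra].
      replace ((p (f (RtoC (t + h) * z)%C) - p (f (RtoC t * z)%C)) / h - p (f' (RtoC t * z) * z)%C)
        with (/ h * p (f (RtoC (t + h) * z) - f (RtoC t * z) - f' (RtoC t * z) * (RtoC h * z))%C).
      + rewrite Rabs_mult, Rabs_inv.
        apply Rmult_le_reg_l with (Rabs h); trivial.
        rewrite <- Rmult_assoc, Rinv_r, Rmult_1_l by lra.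
        apply Rle_trans with (1 := pn _). apply Rle_trans with (1 := K).
        replace (e / (2 * (1 + Cmod z)) * (Rabs h * Cmod z))
          with (Rabs h * (e / 2 * (Cmod z / (1 + Cmod z)))) by (field; lra).
        apply Rmult_le_compat_l; [lra|].
        rewrite <- (Rmult_1_r (e / 2)) at 2. apply Rmult_le_compat_l; [lra|].
        apply Rmult_le_reg_r with (1 + Cmod z); [lra|]. unfold Rdiv.
        rewrite Rmult_assoc, Rinv_l by lra. lra.
      + rewrite !pm.
        replace (f' (RtoC t * z) * (RtoC h * z))%C with (RtoC h * (f' (RtoC t * z) * z))%C by ring.
        rewrite ps. field. trivial.
    - apply Rle_trans with (1 := pn _). rewrite Cmod_mult.
      apply Rmult_le_compat_r; trivial. apply Cmod_ge_0. }
  rewrite Cmult_1_l, Cmult_0_l, Rminus_0_r, Rabs_R1, Rmult_1_r in B. exact B.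
Qed.

(** Real and imaginary parts are bounded separately, which costs the factor 2; only orders of
    magnitude matter later. *)
Lemma Cmean_value (f f' : C -> C) (z : C) (M : R) :
  (forall w : C, Cmod w <= Cmod z -> is_Cderive f w (f' w) /\ Cmod (f' w) <= M) ->
  Cmod (f z - f 0%C)%C <= 2 * M * Cmod z.
Proof.
  intros H. apply Rle_trans with (1 := Cmod_le_Re_Im _).
  assert (A := functional_mean_value Re f f' z M).
  assert (B := functional_mean_value Im f f' z M).
  assert (EA : Re (f z - f 0)%C = Re (f z) - Re (f 0%C)) by reflexivity.
  assert (EB : Im (f z - f 0)%C = Im (f z) - Im (f 0%C)) by reflexivity.
  rewrite EA, EB.
  specialize (A (fun _ _ => eq_refl) re_scal_l re_le_Cmod H).
  specialize (B (fun _ _ => eq_refl) im_scal_l Rabs_le_Cmod_Im H).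
  lra.
Qed.

(** * Derivatives of the complex exponential, sine and cosine *)

Lemma Cexp_plus (z w : C) : Cexp (z + w)%C = (Cexp z * Cexp w)%C.
Proof.
  destruct z as [a b], w as [c d]. unfold Cexp, Cmult; simpl.
  rewrite exp_plus, cos_plus, sin_plus. f_equal; ring.
Qed.

Lemma Rderive_eps (f : R -> R) (x l e : R) :
  derivable_pt_lim f x l -> 0 < e ->
  exists d, 0 < d /\ forall h, Rabs h < d -> Rabs (f (x + h) - f x - l * h) <= e * Rabs h.
Proof.
  intros H He. destruct (H e He) as [d K]. exists d. split. apply cond_pos.
  intros h Hh. destruct (Req_dec h 0) as [->|N].
  - rewrite Rplus_0_r, Rabs_R0. replace (f x - f x - l * 0) with 0 by ring. rewrite Rabs_R0. lra.
  - specialize (K h N Hh).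
    replace (f (x + h) - f x - l * h) with (((f (x + h) - f x) / h - l) * h) by now field.
    rewrite Rabs_mult. apply Rmult_le_compat_r. apply Rabs_pos. lra.
Qed.

Lemma is_Cderive_exp_0 : is_Cderive Cexp 0%C 1%C.
Proof.
  apply is_Cderive_eps. intros e He.
  (* With m = |h| < k, the errors of [exp], [cos] and [sin] combine to at most 9 k m, so 20 leaves a
     margin. The bound k <= 1 keeps |1 + a + E| below 3, and m < k turns m^2 into k m. *)
  set (k := Rmin 1 (e / 20)).
  assert (Hk : 0 < k) by (apply Rmin_pos; lra).
  assert (k1 : k <= 1) by apply Rmin_l.
  assert (k2 : k <= e / 20) by apply Rmin_r.
  destruct (Rderive_eps exp 0 _ k (derivable_pt_lim_exp 0) Hk) as (d1 & p1 & D1).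
  destruct (Rderive_eps cos 0 _ k (derivable_pt_lim_cos 0) Hk) as (d2 & p2 & D2).
  destruct (Rderive_eps sin 0 _ k (derivable_pt_lim_sin 0) Hk) as (d3 & p3 & D3).
  exists (Rmin (Rmin k d1) (Rmin d2 d3)). split.
  { apply Rmin_pos; apply Rmin_pos; trivial. }
  intros h Hh.
  assert (B1 := Rlt_le_trans _ _ _ Hh (Rmin_l _ _)).
  assert (B2 := Rlt_le_trans _ _ _ Hh (Rmin_r _ _)).
  assert (Hk' := Rlt_le_trans _ _ _ B1 (Rmin_l _ _)).
  assert (Hd1 := Rlt_le_trans _ _ _ B1 (Rmin_r _ _)).
  assert (Hd2 := Rlt_le_trans _ _ _ B2 (Rmin_l _ _)).
  assert (Hd3 := Rlt_le_trans _ _ _ B2 (Rmin_r _ _)).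
  destruct h as [a b].
  assert (Ha : Rabs a <= Cmod (a, b)) by apply (re_le_Cmod (a, b)).
  assert (Hb : Rabs b <= Cmod (a, b)) by apply (Rabs_le_Cmod_Im (a, b)).
  specialize (D1 a ltac:(lra)). specialize (D2 b ltac:(lra)). specialize (D3 b ltac:(lra)).
  rewrite ?exp_0, ?cos_0, ?sin_0, ?Rplus_0_l, ?Rminus_0_r, ?Ropp_0, ?Rmult_0_l, ?Rmult_1_l, ?Rminus_0_r in *.
  set (m := Cmod (a, b)) in *. clearbody m.
  assert (m0 : 0 <= m) by (assert (X := Rabs_pos a); lra).
  apply Rle_trans with (1 := Cmod_le_Re_Im _).
  unfold Cexp, Cminus, Cplus, Copp, Cmult, RtoC; simpl.
  rewrite ?Rplus_0_l, exp_0, cos_0, sin_0.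
  set (E := exp a - 1 - a) in *. set (c := cos b - 1) in *. set (s := sin b - b) in *.
  replace (exp a) with (1 + a + E) by (unfold E; ring).
  replace (cos b) with (1 + c) by (unfold c; ring).
  replace (sin b) with (b + s) by (unfold s; ring).
  clearbody E c s.
  replace ((1 + a + E) * (1 + c) + - (1 * 1) + - (1 * a - 0 * b))
    with (E + (1 + a + E) * c) by ring.
  replace ((1 + a + E) * (b + s) + - (1 * 0) + - (1 * b + 0 * a))
    with ((1 + a + E) * s + (a + E) * b) by ring.
  assert (HE : Rabs E <= k * m) by nra.
  assert (Hc : Rabs c <= k * m) by nra.
  assert (Hs : Rabs s <= k * m) by nra.
  assert (HaE : Rabs (a + E) <= 2 * m).
  { apply Rle_trans with (1 := Rabs_triang _ _). nra. }
  assert (H1 : Rabs (1 + a + E) <= 3).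
  { rewrite Rplus_assoc. apply Rle_trans with (1 := Rabs_triang _ _). rewrite Rabs_R1. lra. }
  assert (T1 : Rabs (E + (1 + a + E) * c) <= k * m + 3 * (k * m)).
  { apply Rle_trans with (1 := Rabs_triang _ _). rewrite Rabs_mult.
    apply Rplus_le_compat; trivial. apply Rmult_le_compat; trivial; apply Rabs_pos. }
  assert (T2 : Rabs ((1 + a + E) * s + (a + E) * b) <= 3 * (k * m) + (2 * m) * m).
  { apply Rle_trans with (1 := Rabs_triang _ _). rewrite !Rabs_mult.
    apply Rplus_le_compat; apply Rmult_le_compat; trivial; apply Rabs_pos. }
  assert (m * m <= k * m) by nra.
  apply Rle_trans with (20 * k * m). nra. apply Rmult_le_compat_r; lra.
Qed.

(** The addition law carries the derivative at the origin to every point. *)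
Lemma is_Cderive_exp (z : C) : is_Cderive Cexp z (Cexp z).
Proof.
  apply is_Cderive_eq_fun with (f := fun w => (Cexp z * Cexp (w - z))%C).
  { intros t. rewrite <- Cexp_plus. f_equal. ring. }
  apply is_Cderive_eq_val with (Cexp z * (1 * 1))%C; [ring|].
  apply is_Cderive_scal.
  apply (is_Cderive_comp Cexp (fun w => w - z)%C).
  - unfold Cminus. rewrite Cplus_opp_r. apply is_Cderive_exp_0.
  - apply is_Cderive_eq_val with (1 - 0)%C; [ring|].
    apply is_Cderive_minus. apply is_Cderive_id. apply is_Cderive_const.
Qed.

Lemma is_Cderive_exp_lin (c z : C) : is_Cderive (fun w => Cexp (c * w)) z (c * Cexp (c * z))%C.
Proof.
  apply (is_Cderive_comp Cexp (fun w => c * w)%C). apply is_Cderive_exp.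
  apply is_Cderive_eq_val with (c * 1)%C; [ring|]. apply is_Cderive_scal, is_Cderive_id.
Qed.

Lemma Ci_sqr : (Ci * Ci = - 1)%C.
Proof. unfold Ci, Cmult, Copp, RtoC; simpl. f_equal; ring. Qed.

Lemma is_Cderive_sin (z : C) : is_Cderive Csin z (Ccos z).
Proof.
  apply is_Cderive_eq_fun with
    (f := fun w => (/ (2 * Ci) * (Cexp (Ci * w) - Cexp (- Ci * w)))%C).
  { intros t. unfold Csin. replace (- (Ci * t))%C with (- Ci * t)%C by ring.
    unfold Cdiv. apply Cmult_comm. }
  replace (Ccos z) with (/ (2 * Ci) * (Ci * Cexp (Ci * z) - - Ci * Cexp (- Ci * z)))%C.
  - apply is_Cderive_scal, is_Cderive_minus; apply is_Cderive_exp_lin.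
  - unfold Ccos. replace (- (Ci * z))%C with (- Ci * z)%C by ring. field. apply Ci_nz.
Qed.

Lemma is_Cderive_cos (z : C) : is_Cderive Ccos z (- Csin z)%C.
Proof.
  apply is_Cderive_eq_fun with
    (f := fun w => (/ 2 * (Cexp (Ci * w) + Cexp (- Ci * w)))%C).
  { intros t. unfold Ccos. replace (- (Ci * t))%C with (- Ci * t)%C by ring.
    unfold Cdiv. apply Cmult_comm. }
  replace (- Csin z)%C with (/ 2 * (Ci * Cexp (Ci * z) + - Ci * Cexp (- Ci * z)))%C.
  - apply is_Cderive_scal, is_Cderive_plus; apply is_Cderive_exp_lin.
  - unfold Csin. replace (- (Ci * z))%C with (- Ci * z)%C by ring.
    replace (Ci * Cexp (Ci * z) + - Ci * Cexp (- Ci * z))%C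
      with (Ci * (Cexp (Ci * z) - Cexp (- Ci * z)))%C by ring.
    replace (/ 2 * (Ci * (Cexp (Ci * z) - Cexp (- Ci * z))))%C
      with (- ((Ci * Ci) * / Ci * - / 2 * (Cexp (Ci * z) - Cexp (- Ci * z))))%C
      by (field; apply Ci_nz).
    rewrite Ci_sqr. field. apply Ci_nz.
Qed.

(** * Orders of vanishing at the origin *)

(** The origin is excluded because most functions here involve division by z. The constant [M] is
    strictly positive so that radii can be divided by it. *)
Definition bigO (n : nat) (g : C -> C) : Prop :=
  exists M d : R, 0 < M /\ 0 < d /\
    forall z : C, z <> 0%C -> Cmod z < d -> Cmod (g z) <= M * Cmod z ^ n.

Lemma bigO_ext_near (n : nat) (f g : C -> C) (d : R) :
  0 < d -> (forall z : C, z <> 0%C -> Cmod z < d -> f z = g z) -> bigO n f -> bigO n g.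
Proof.
  intros Hd E (M & d' & HM & Hd' & H). exists M, (Rmin d d').
  split; [exact HM|]. split; [now apply Rmin_pos|].
  intros z Hz B. rewrite <- E; trivial; [apply H; trivial|];
    apply Rlt_le_trans with (1 := B). apply Rmin_r. apply Rmin_l.
Qed.

Lemma bigO_ext (n : nat) (f g : C -> C) :
  (forall z : C, z <> 0%C -> f z = g z) -> bigO n f -> bigO n g.
Proof. intros E. apply bigO_ext_near with 1; [lra|]. intros z Hz _. now apply E. Qed.

Lemma bigO_plus (n : nat) (f g : C -> C) :
  bigO n f -> bigO n g -> bigO n (fun z => f z + g z)%C.
Proof.
  intros (M & d & HM & Hd & H) (M' & d' & HM' & Hd' & H').
  exists (M + M'), (Rmin d d'). split; [lra|]. split; [now apply Rmin_pos|].
  intros z Hz B. apply Rle_trans with (1 := Cmod_triangle _ _).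
  rewrite Rmult_plus_distr_r. apply Rplus_le_compat; [apply H | apply H']; trivial;
    apply Rlt_le_trans with (1 := B). apply Rmin_l. apply Rmin_r.
Qed.

Lemma bigO_mult (n m : nat) (f g : C -> C) :
  bigO n f -> bigO m g -> bigO (n + m) (fun z => f z * g z)%C.
Proof.
  intros (M & d & HM & Hd & H) (M' & d' & HM' & Hd' & H').
  exists (M * M'), (Rmin d d'). split; [nra|]. split; [now apply Rmin_pos|].
  intros z Hz B. rewrite Cmod_mult, pow_add.
  replace (M * M' * (Cmod z ^ n * Cmod z ^ m)) with ((M * Cmod z ^ n) * (M' * Cmod z ^ m)) by ring.
  apply Rmult_le_compat; try apply Cmod_ge_0; [apply H | apply H']; trivial;
    apply Rlt_le_trans with (1 := B). apply Rmin_l. apply Rmin_r.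
Qed.

Lemma bigO_le (n m : nat) (f : C -> C) : (m <= n)%nat -> bigO n f -> bigO m f.
Proof.
  intros L (M & d & HM & Hd & H). exists M, (Rmin 1 d).
  split; [exact HM|]. split; [apply Rmin_pos; lra|].
  intros z Hz B.
  assert (B1 := Rlt_le_trans _ _ _ B (Rmin_l _ _)).
  assert (B2 := Rlt_le_trans _ _ _ B (Rmin_r _ _)).
  apply Rle_trans with (1 := H z Hz B2). apply Rmult_le_compat_l; [lra|].
  replace n with (m + (n - m))%nat by lia. rewrite pow_add.
  rewrite <- (Rmult_1_r (Cmod z ^ m)) at 2. apply Rmult_le_compat_l.
  apply pow_le, Cmod_ge_0. rewrite <- (pow1 (n - m)). apply pow_incr.
  split; [apply Cmod_ge_0 | lra].
Qed.

Lemma bigO_const (c : C) : bigO 0 (fun _ => c).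
Proof.
  exists (Cmod c + 1), 1. assert (X := Cmod_ge_0 c).
  split; [lra|]. split; [lra|]. intros z _ _. simpl. lra.
Qed.

Lemma bigO_pow (n : nat) : bigO n (fun z => z ^ n)%C.
Proof.
  exists 1, 1. split; [lra|]. split; [lra|]. intros z _ _. rewrite Cmod_pow. lra.
Qed.

Lemma bigO_0 (n : nat) : bigO n (fun _ => 0%C).
Proof.
  apply bigO_ext with (fun z => 0 * z ^ n)%C. intros; ring.
  apply (bigO_mult 0 n (fun _ => 0%C)). apply bigO_const. apply bigO_pow.
Qed.

Lemma bigO_id : bigO 1 (fun z => z).
Proof. apply bigO_ext with (2 := bigO_pow 1). intros; simpl; ring. Qed.

Lemma bigO_scal (n : nat) (c : C) (f : C -> C) : bigO n f -> bigO n (fun z => c * f z)%C.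
Proof. apply (bigO_mult 0 n (fun _ => c)), bigO_const. Qed.

Lemma bigO_opp (n : nat) (f : C -> C) : bigO n f -> bigO n (fun z => - f z)%C.
Proof.
  intros H. apply bigO_ext with (fun z => (-(1)) * f z)%C; [intros; ring|].
  now apply bigO_scal.
Qed.

Lemma bigO_minus (n : nat) (f g : C -> C) :
  bigO n f -> bigO n g -> bigO n (fun z => f z - g z)%C.
Proof. intros H K. apply (bigO_plus n f (fun z => - g z)%C H). now apply bigO_opp. Qed.

Lemma bigO_div_pow (n m : nat) (f : C -> C) :
  bigO (n + m) f -> bigO n (fun z => f z / z ^ m)%C.
Proof.
  intros (M & d & HM & Hd & H). exists M, d. split; [exact HM|]. split; [exact Hd|].
  intros z Hz B. specialize (H z Hz B).
  assert (P : 0 < Cmod z ^ m) by (apply pow_lt; now apply Cmod_gt_0).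
  rewrite Cmod_div, Cmod_pow by now apply Cpow_nz.
  apply Rmult_le_reg_r with (1 := P). unfold Rdiv. rewrite Rmult_assoc, Rinv_l by lra.
  rewrite pow_add in H. lra.
Qed.

Lemma bigO_div (n : nat) (f : C -> C) : bigO (S n) f -> bigO n (fun z => f z / z)%C.
Proof.
  intros H. apply bigO_ext with (fun z => f z / z ^ 1)%C.
  - intros z Hz. rewrite Cpow_1_r. reflexivity.
  - apply bigO_div_pow. now rewrite Nat.add_1_r.
Qed.

(** Since [bigO] says nothing at the origin, the inner function must avoid it; [1 <= m] makes the
    inner function small enough to enter the disc where [g] is controlled. *)
Lemma bigO_comp (n m : nat) (g v : C -> C) (d0 : R) :
  (1 <= m)%nat -> 0 < d0 -> (forall z : C, z <> 0%C -> Cmod z < d0 -> v z <> 0%C) ->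
  bigO n g -> bigO m v -> bigO (n * m) (fun z => g (v z)).
Proof.
  intros Hm Hd0 Hv (M & d & HM & Hd & H) K.
  destruct (bigO_le m 1 v Hm K) as (M1 & d1 & HM1 & Hd1 & K1).
  destruct K as (M' & d' & HM' & Hd' & K).
  exists (M * M' ^ n), (Rmin (Rmin d0 d') (Rmin d1 (d / M1))).
  assert (P : 0 < M' ^ n) by now apply pow_lt.
  split; [nra|]. split.
  { apply Rmin_pos; apply Rmin_pos; trivial. now apply Rdiv_lt_0_compat. }
  intros z Hz B.
  assert (B1 := Rlt_le_trans _ _ _ B (Rmin_l _ _)).
  assert (B2 := Rlt_le_trans _ _ _ B (Rmin_r _ _)).
  assert (C1 := Rlt_le_trans _ _ _ B1 (Rmin_l _ _)).
  assert (C2 := Rlt_le_trans _ _ _ B1 (Rmin_r _ _)).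
  assert (C3 := Rlt_le_trans _ _ _ B2 (Rmin_l _ _)).
  assert (C4 := Rlt_le_trans _ _ _ B2 (Rmin_r _ _)).
  specialize (K1 z Hz C3). specialize (K z Hz C2).
  assert (V : Cmod (v z) < d).
  { apply Rle_lt_trans with (1 := K1). rewrite pow_1.
    replace d with (M1 * (d / M1)) by (field; lra). now apply Rmult_lt_compat_l. }
  apply Rle_trans with (1 := H _ (Hv z Hz C1) V).
  rewrite Rmult_assoc. apply Rmult_le_compat_l; [lra|].
  rewrite Nat.mul_comm, pow_mult, <- Rpow_mult_distr.
  apply pow_incr. split; [apply Cmod_ge_0 | exact K].
Qed.

Lemma ball_Cmod (z : C) (d : posreal) :
  Cmod z < d -> @ball C_UniformSpace (RtoC 0) d z.
Proof.
  intros H. apply C_NormedModule_mixin_compat1.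
  unfold minus, plus, opp; simpl. rewrite Copp_0, Cplus_0_r. exact H.
Qed.

(** Balls of the uniform structure are taken coordinatewise, hence the factor sqrt 2 in one
    direction. *)
Lemma locally'_Cmod (P : C -> Prop) :
  locally' (RtoC 0) P <->
  exists d : R, 0 < d /\ forall z : C, z <> 0%C -> Cmod z < d -> P z.
Proof.
  split.
  - intros [d H]. exists d. split. apply cond_pos. intros z Hz B.
    apply H; trivial. now apply ball_Cmod.
  - intros (d & Hd & H).
    assert (Hd' : 0 < d / sqrt 2) by (apply Rdiv_lt_0_compat; trivial; apply Rlt_sqrt2_0).
    exists (mkposreal _ Hd'). intros z B Hz. apply H; trivial.
    apply C_NormedModule_mixin_compat2 in B.
    unfold minus, plus, opp in B; simpl in B. rewrite Copp_0, Cplus_0_r in B.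
    replace d with (sqrt 2 * (d / sqrt 2)); trivial.
    field. apply Rgt_not_eq, Rlt_sqrt2_0.
Qed.

Lemma eq_mod_bigO_iff (g h : C -> C) (n : nat) :
  eq_mod_bigO g h n <-> bigO n (fun z => g z - h z)%C.
Proof.
  split.
  - intros [M H]. apply locally'_Cmod in H. destruct H as (d & Hd & H).
    exists (Rabs M + 1), d. assert (X := Rabs_pos M). split; [lra|]. split; [exact Hd|].
    intros z Hz B. apply Rle_trans with (1 := H z Hz B).
    apply Rmult_le_compat_r. apply pow_le, Cmod_ge_0. assert (Y := Rle_abs M). lra.
  - intros (M & d & HM & Hd & H). exists M. apply locally'_Cmod. now exists d.
Qed.

(** * Remainders with controlled derivatives *)

(** [flat k n r]: [r] is [O(z^(n+k))], and each of its first [k] derivatives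
    loses at most one order. *)
Fixpoint flat (k n : nat) (r : C -> C) : Prop :=
  bigO (n + k) r /\
  match k with
  | O => True
  | S k' => exists r' : C -> C,
      (forall z : C, z <> 0%C -> is_Cderive r z (r' z)) /\ flat k' n r'
  end.

Lemma flat_bigO (k n : nat) (r : C -> C) : flat k n r -> bigO (n + k) r.
Proof. destruct k; now intros [H _]. Qed.

(** One controlled derivative is given up; the total order n + k stays the same. *)
Lemma flat_weaken (k : nat) : forall (n : nat) (r : C -> C), flat (S k) n r -> flat k (S n) r.
Proof.
  induction k as [|k IH]; intros n r [B (r' & D & H)]; simpl.
  - split; trivial. now replace (S (n + 0)) with (n + 1)%nat by lia.
  - split. now replace (S (n + S k)) with (n + S (S k))%nat by lia.
    exists r'. split; trivial. now apply IH.
Qed.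

Lemma flat_plus (k : nat) : forall (n : nat) (r s : C -> C),
  flat k n r -> flat k n s -> flat k n (fun z => r z + s z)%C.
Proof.
  induction k as [|k IH]; intros n r s [B H] [B' H']; (split; [now apply bigO_plus|]); trivial.
  destruct H as (r' & D & H), H' as (s' & D' & H').
  exists (fun z => r' z + s' z)%C. split.
  intros z Hz. apply is_Cderive_plus; auto. now apply IH.
Qed.

Lemma flat_scal (k : nat) : forall (n : nat) (c : C) (r : C -> C),
  flat k n r -> flat k n (fun z => c * r z)%C.
Proof.
  induction k as [|k IH]; intros n c r [B H]; (split; [now apply bigO_scal|]); trivial.
  destruct H as (r' & D & H). exists (fun z => c * r' z)%C. split.
  intros z Hz. apply is_Cderive_scal; auto. now apply IH.
Qed.

Lemma flat_ext (k : nat) (n : nat) (r s : C -> C) :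
  (forall z : C, z <> 0%C -> r z = s z) -> flat k n r -> flat k n s.
Proof.
  intros E. destruct k as [|k]; intros [B H]; (split; [exact (bigO_ext _ _ _ E B)|]); trivial.
  destruct H as (r' & D & H). exists r'. split; trivial.
  intros z Hz. apply is_Cderive_ext with r; auto.
Qed.

(** The derivative of r/z is r'/z - (r/z)/z. The second term divides twice, which is affordable
    because giving up one derivative of r gains one order. *)
Lemma flat_div (k : nat) : forall (n : nat) (r : C -> C),
  flat k (S n) r -> flat k n (fun z => r z / z)%C.
Proof.
  induction k as [|k IH]; intros n r H0; assert (B := flat_bigO _ _ _ H0); split;
    try (apply bigO_div; exact B); trivial.
  destruct H0 as [B' (r' & D & H)].
  exists (fun z => r' z / z + (- (1)) * (r z / z / z))%C. split.
  - intros z Hz. apply is_Cderive_eq_val with (r' z * / z + r z * - / (z * z))%C; [now field|].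
    apply is_Cderive_mult. now apply D. now apply is_Cderive_inv.
  - apply flat_plus. now apply IH.
    apply flat_scal, IH, IH. apply flat_weaken. split; trivial. now exists r'.
Qed.

Lemma flat_mult_id (k : nat) : forall (n : nat) (r : C -> C),
  flat k n r -> flat k (S n) (fun z => z * r z)%C.
Proof.
  induction k as [|k IH]; intros n r H0; assert (B := flat_bigO _ _ _ H0); split;
    try (apply (bigO_mult 1 _ (fun z => z)); [apply bigO_id | exact B]); trivial.
  assert (W := flat_weaken _ _ _ H0). destruct H0 as [B' (r' & D & H)].
  exists (fun z => r z + z * r' z)%C. split.
  - intros z Hz. apply is_Cderive_eq_val with (1 * r z + z * r' z)%C; [ring|].
    apply (is_Cderive_mult (fun z => z)). apply is_Cderive_id. now apply D.
  - apply flat_plus; trivial. now apply IH.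
Qed.

Lemma flat_mult_pow (m k n : nat) (r : C -> C) :
  flat k n r -> flat k (m + n) (fun z => z ^ m * r z)%C.
Proof.
  intros H. induction m as [|m IH].
  - apply flat_ext with r; trivial. intros; simpl; ring.
  - apply flat_ext with (fun z => z * (z ^ m * r z))%C. intros; simpl; ring.
    now apply flat_mult_id.
Qed.

(** * Real polynomials as lists of coefficients *)

Fixpoint peval (L : list R) (u : C) : C :=
  match L with
  | [] => 0%C
  | r :: t => (RtoC r + u * peval t u)%C
  end.

(* On [z^a p(z^2)] the operator [z d/dz] multiplies the coefficient of [z^(a+2k)] by [a + 2k]. *)
Fixpoint euler_op (a : R) (L : list R) : list R :=
  match L with
  | [] => []
  | r :: t => a * r :: euler_op (a + 2) t
  end.

Fixpoint coeffs (f : nat -> R) (N : nat) : list R :=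
  match N with
  | O => []
  | S N' => f O :: coeffs (fun k => f (S k)) N'
  end.

Lemma coeffs_ext (N : nat) : forall f g : nat -> R,
  (forall k, f k = g k) -> coeffs f N = coeffs g N.
Proof.
  induction N as [|N IH]; intros f g E; simpl; trivial. f_equal; trivial. now apply IH.
Qed.

Lemma euler_op_coeffs (N : nat) : forall (a : R) (f : nat -> R),
  euler_op a (coeffs f N) = coeffs (fun k => (a + 2 * INR k) * f k) N.
Proof.
  induction N as [|N IH]; intros a f; simpl; trivial. f_equal.
  - ring.
  - rewrite IH. apply coeffs_ext. intros k.
    change (match k with 0%nat => 1 | S _ => INR k + 1 end) with (INR (S k)).
    rewrite S_INR. ring.
Qed.

Lemma peval_coeffs_scal (N : nat) : forall (c : R) (f : nat -> R) (u : C),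
  peval (coeffs (fun k => c * f k) N) u = (RtoC c * peval (coeffs f N) u)%C.
Proof.
  induction N as [|N IH]; intros c f u; simpl. ring.
  rewrite (IH c (fun k => f (S k))), RtoC_mult. ring.
Qed.

(** This is the product rule for z d/dz applied to z^a times z^b p(z^2). *)
Lemma peval_euler_plus (L : list R) : forall (a b : R) (u : C),
  peval (euler_op (a + b) L) u = (RtoC a * peval L u + peval (euler_op b L) u)%C.
Proof.
  induction L as [|r t IH]; intros a b u; simpl. ring.
  replace (a + b + 2) with (a + (b + 2)) by ring.
  rewrite IH, !RtoC_mult, RtoC_plus. ring.
Qed.

Lemma peval_euler_0 (L : list R) (u : C) :
  peval (euler_op 0 L) u = (u * peval (euler_op 2 (tl L)) u)%C.
Proof.
  destruct L as [|r t]; simpl. ring. rewrite Rmult_0_l, Rplus_0_l. ring.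
Qed.

(** [euler_op 2 (tl L)] has the entries 2(k+1) a_(k+1), so it represents twice the derivative of the
    polynomial [L]. *)
Lemma is_Cderive_peval_sqr (L : list R) (z : C) :
  is_Cderive (fun w => peval L (w * w)%C) z (z * peval (euler_op 2 (tl L)) (z * z))%C.
Proof.
  induction L as [|r t IH]; simpl.
  - rewrite Cmult_0_r. apply is_Cderive_const.
  - apply is_Cderive_eq_val with
      (0 + ((1 * z + z * 1) * peval t (z * z)
            + (z * z) * (z * peval (euler_op 2 (tl t)) (z * z))))%C.
    + assert (E := peval_euler_plus t 2 0 (z * z)%C).
      rewrite Rplus_0_r, peval_euler_0 in E.
      rewrite E. ring.
    + apply (is_Cderive_plus (fun _ => RtoC r)). apply is_Cderive_const.
      apply (is_Cderive_mult (fun w => w * w)%C (fun w => peval t (w * w)%C)); trivial.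
      apply (is_Cderive_mult (fun w => w) (fun w => w)); apply is_Cderive_id.
Qed.

Lemma is_Cderive_pow_peval (m : nat) (L : list R) (z : C) :
  is_Cderive (fun w => w ^ S m * peval L (w * w))%C z
    (z ^ m * peval (euler_op (INR (S m)) L) (z * z))%C.
Proof.
  apply is_Cderive_eq_val with
    (RtoC (INR (S m)) * z ^ (S m - 1) * peval L (z * z)
     + z ^ S m * (z * peval (euler_op 2 (tl L)) (z * z)))%C.
  - assert (E := peval_euler_plus L (INR (S m)) 0 (z * z)%C).
    rewrite Rplus_0_r, peval_euler_0 in E. rewrite E. replace (S m - 1)%nat with m by lia.
    simpl Cpow. ring.
  - apply (is_Cderive_mult (fun w => w ^ S m)%C (fun w => peval L (w * w)%C)). apply is_Cderive_pow.
    apply is_Cderive_peval_sqr.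
Qed.

Lemma is_Cderive_invpow_peval (q : nat) (L : list R) (z : C) : z <> 0%C ->
  is_Cderive (fun w => / w ^ q * peval L (w * w))%C z
    (/ z ^ S q * peval (euler_op (- INR q) L) (z * z))%C.
Proof.
  intros Hz. assert (Hq := Cpow_nz z q Hz).
  apply is_Cderive_eq_val with
    ((RtoC (INR q) * z ^ (q - 1)) * (- / (z ^ q * z ^ q)) * peval L (z * z)
     + / z ^ q * (z * peval (euler_op 2 (tl L)) (z * z)))%C.
  - assert (E := peval_euler_plus L (- INR q) 0 (z * z)%C).
    rewrite Rplus_0_r, peval_euler_0, RtoC_opp in E. rewrite E. destruct q as [|q].
    + simpl. field; trivial.
    + replace (S q - 1)%nat with q by lia. simpl Cpow in *.
      assert (z ^ q <> 0)%C by now apply Cpow_nz. field. auto.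
  - apply (is_Cderive_mult (fun w => / w ^ q)%C (fun w => peval L (w * w)%C)).
    + apply (is_Cderive_comp Cinv (fun w => w ^ q)%C).
      now apply is_Cderive_inv. apply is_Cderive_pow.
    + apply is_Cderive_peval_sqr.
Qed.

(** * Taylor remainders of sine and cosine *)

(** This is (2k-1)!!. At [k = 0] the truncated subtraction gives [double_fact 0 = 1], the usual
    value of (-1)!!, so the recursion holds from the start. *)
Definition odd_fact (k : nat) : R := INR (double_fact (2 * k - 1)).

Lemma odd_fact_S (k : nat) : odd_fact (S k) = (2 * INR k + 1) * odd_fact k.
Proof.
  unfold odd_fact. destruct k as [|k]. simpl; ring.
  replace (2 * S (S k) - 1)%nat with (S (S (2 * k + 1))) by lia.
  replace (2 * S k - 1)%nat with (2 * k + 1)%nat by lia.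
  change (double_fact (S (S (2 * k + 1)))) with (S (S (2 * k + 1)) * double_fact (2 * k + 1))%nat.
  rewrite mult_INR, !S_INR, plus_INR, mult_INR. simpl. ring.
Qed.

Lemma odd_fact_pos (k : nat) : 0 < odd_fact k.
Proof.
  induction k as [|k IH]. unfold odd_fact; simpl; lra.
  rewrite odd_fact_S. assert (X := pos_INR k). nra.
Qed.

(* Coefficients of [j_i(z) / (-z)^i] as a power series in [z^2]; for [i = 0], of [sin z / z]. *)
Definition j_coeff (i k : nat) : R :=
  (-1) ^ (k + i) / (2 ^ k * INR (fact k) * odd_fact (i + k + 1)).

(** The denominator is (2k)! factored as 2^k k! (2k-1)!!, to match the shape of [j_coeff]. *)
Definition cos_coeff (k : nat) : R :=
  (-1) ^ k / (2 ^ k * INR (fact k) * odd_fact k).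

Lemma fact_S_INR (k : nat) : INR (fact (S k)) = (INR k + 1) * INR (fact k).
Proof. now rewrite fact_simpl, mult_INR, S_INR. Qed.

(** Coefficient form of the fact that (1/z) d/dz maps j_i(z)/(-z)^i to minus z-free form of the next
    index: one Rayleigh step raises [i] by one. *)
Lemma j_coeff_shift (i k : nat) :
  (2 + 2 * INR k) * j_coeff i (S k) = j_coeff (S i) k.
Proof.
  unfold j_coeff. rewrite fact_S_INR.
  replace (S k + i)%nat with (k + S i)%nat by lia.
  replace (i + S k + 1)%nat with (S i + k + 1)%nat by lia.
  simpl (2 ^ S k).
  assert (A := pow_lt 2 k ltac:(lra)). assert (B := INR_fact_lt_0 k).
  assert (D := odd_fact_pos (S i + k + 1)). assert (X := pos_INR k).
  field. repeat split; lra.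
Qed.

Lemma sin_coeff_derive (k : nat) : (1 + 2 * INR k) * j_coeff 0 k = cos_coeff k.
Proof.
  unfold j_coeff, cos_coeff. rewrite Nat.add_0_r.
  replace (0 + k + 1)%nat with (S k) by lia. rewrite odd_fact_S.
  assert (A := pow_lt 2 k ltac:(lra)). assert (B := INR_fact_lt_0 k).
  assert (D := odd_fact_pos k). assert (X := pos_INR k).
  field. repeat split; lra.
Qed.

Lemma cos_coeff_derive (k : nat) : (2 + 2 * INR k) * cos_coeff (S k) = -1 * j_coeff 0 k.
Proof.
  unfold j_coeff, cos_coeff. rewrite Nat.add_0_r, fact_S_INR.
  replace (0 + k + 1)%nat with (S k) by lia. simpl ((-1) ^ S k). simpl (2 ^ S k).
  assert (A := pow_lt 2 k ltac:(lra)). assert (B := INR_fact_lt_0 k).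
  assert (D := odd_fact_pos (S k)). assert (X := pos_INR k).
  field. repeat split; lra.
Qed.

Definition sin_rem (N : nat) (z : C) : C :=
  (Csin z - z * peval (coeffs (j_coeff 0) N) (z * z))%C.

Definition cos_rem (N : nat) (z : C) : C :=
  (Ccos z - peval (coeffs cos_coeff N) (z * z))%C.

Lemma is_Cderive_sin_rem (N : nat) (z : C) : is_Cderive (sin_rem N) z (cos_rem N z).
Proof.
  apply is_Cderive_eq_fun with
    (fun w => Csin w - w ^ 1 * peval (coeffs (j_coeff 0) N) (w * w))%C.
  { intros w. unfold sin_rem. now rewrite Cpow_1_r. }
  apply is_Cderive_minus. apply is_Cderive_sin.
  apply is_Cderive_eq_val with (2 := is_Cderive_pow_peval 0 _ z).
  rewrite euler_op_coeffs. simpl INR. rewrite (coeffs_ext _ _ _ sin_coeff_derive).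
  simpl. ring.
Qed.

Lemma is_Cderive_cos_rem (N : nat) (z : C) : is_Cderive (cos_rem (S N)) z (- sin_rem N z)%C.
Proof.
  apply is_Cderive_eq_val with
    (- Csin z - z * peval (euler_op 2 (tl (coeffs cos_coeff (S N)))) (z * z))%C.
  - simpl tl. rewrite euler_op_coeffs, (coeffs_ext _ _ _ cos_coeff_derive), peval_coeffs_scal.
    unfold sin_rem. ring.
  - apply is_Cderive_minus. apply is_Cderive_cos. apply is_Cderive_peval_sqr.
Qed.

Lemma Cexp_0 : Cexp 0%C = 1%C.
Proof. unfold Cexp; simpl. rewrite exp_0, cos_0, sin_0. unfold RtoC. f_equal; ring. Qed.

Lemma Csin_0 : Csin 0%C = 0%C.
Proof.
  unfold Csin. replace (- (Ci * RtoC 0))%C with (Ci * RtoC 0)%C by ring.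
  unfold Cdiv, Cminus. rewrite Cplus_opp_r. ring.
Qed.

Lemma Ccos_0 : Ccos 0%C = 1%C.
Proof.
  unfold Ccos. replace (- (Ci * 0))%C with (RtoC 0) by ring.
  rewrite Cmult_0_r, Cexp_0. field.
Qed.

(** The mean value inequality takes the place of an integral: on the disc of radius |z| the
    derivative is at most M |z|^n. *)
Lemma Cprimitive_bound (f f' : C -> C) (n : nat) (M d : R) :
  0 <= M -> f 0%C = 0%C ->
  (forall z, is_Cderive f z (f' z)) ->
  (forall z, Cmod z < d -> Cmod (f' z) <= M * Cmod z ^ n) ->
  forall z, Cmod z < d -> Cmod (f z) <= 2 * M * Cmod z ^ S n.
Proof.
  intros HM f0 D B z Hz.
  replace (2 * M * Cmod z ^ S n) with (2 * (M * Cmod z ^ n) * Cmod z) by (simpl; ring).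
  replace (f z) with (f z - f 0%C)%C by (rewrite f0; ring).
  apply Cmean_value with f'. intros w Hw. split; trivial.
  apply Rle_trans with (1 := B w ltac:(lra)). apply Rmult_le_compat_l; trivial.
  apply pow_incr. split; trivial. apply Cmod_ge_0.
Qed.

(** The bounds are integrated alternately, from [cos_rem N] to [sin_rem N] and from there to
    [cos_rem (S N)]; each passage gains one order and doubles the constant. *)
Lemma sin_cos_rem_bound (N : nat) :
  exists M d : R, 0 < M /\ 0 < d /\ forall z, Cmod z < d ->
    Cmod (cos_rem N z) <= M * Cmod z ^ (2 * N) /\
    Cmod (sin_rem N z) <= M * Cmod z ^ (2 * N + 1).
Proof.
  assert (Hsin : forall N M d, 0 < M -> 0 < d ->
    (forall z, Cmod z < d -> Cmod (cos_rem N z) <= M * Cmod z ^ (2 * N)) ->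
    forall z, Cmod z < d -> Cmod (sin_rem N z) <= 2 * M * Cmod z ^ (2 * N + 1)).
  { clear N. intros N M d HM Hd H. rewrite Nat.add_1_r.
    apply (Cprimitive_bound (sin_rem N) (cos_rem N)); trivial. lra.
    unfold sin_rem. rewrite Csin_0. ring. intros; apply is_Cderive_sin_rem. }
  induction N as [|N IH].
  (* [cos_rem 0] is the cosine itself; differentiability at the origin with tolerance 1 bounds it by
     1 + |z|, hence by 2. *)
  - destruct (proj1 (is_Cderive_eps _ _ _) (is_Cderive_cos 0%C) 1 Rlt_0_1) as (d & Hd & H).
    assert (K : forall z, Cmod z < Rmin 1 d -> Cmod (cos_rem 0 z) <= 2 * Cmod z ^ (2 * 0)).
    { intros z Hz. assert (B1 := Rlt_le_trans _ _ _ Hz (Rmin_l _ _)).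
      specialize (H z (Rlt_le_trans _ _ _ Hz (Rmin_r _ _))).
      rewrite Ccos_0, Csin_0, Cplus_0_l in H. unfold cos_rem; simpl.
      replace (Ccos z - 1 - - 0 * z)%C with (Ccos z - 1)%C in H by ring.
      replace (Ccos z - 0)%C with ((Ccos z - 1) + 1)%C by ring.
      apply Rle_trans with (1 := Cmod_triangle _ _). rewrite Cmod_1. lra. }
    exists (2 * 2), (Rmin 1 d). split; [lra|]. split; [apply Rmin_pos; lra|].
    intros z Hz. split.
    + apply Rle_trans with (1 := K z Hz). simpl. lra.
    + apply (Hsin _ 2 (Rmin 1 d)); trivial. lra. apply Rmin_pos; lra.
  - destruct IH as (M & d & HM & Hd & H).
    assert (K : forall z, Cmod z < d ->
              Cmod (cos_rem (S N) z) <= 2 * M * Cmod z ^ (2 * S N)).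
    { replace (2 * S N)%nat with (S (2 * N + 1)) by lia.
      apply (Cprimitive_bound _ (fun z => - sin_rem N z)%C). lra.
      - unfold cos_rem. rewrite Ccos_0. simpl coeffs. simpl peval.
        replace (cos_coeff 0) with 1. ring.
        unfold cos_coeff, odd_fact; simpl. field.
      - intros; apply is_Cderive_cos_rem.
      - intros z Hz. rewrite Cmod_opp. now apply H. }
    exists (2 * (2 * M)), d. split; [lra|]. split; [exact Hd|]. intros z Hz. split.
    + apply Rle_trans with (1 := K z Hz). apply Rmult_le_compat_r. apply pow_le, Cmod_ge_0. lra.
    + apply (Hsin _ (2 * M) d); trivial. lra.
Qed.

(** Up to sign the two families of remainders are each other's derivatives, so both claims are
    proved by one induction on the number of derivatives. *)
Lemma flat_sin_cos_rem (k : nat) : forall N n : nat,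
  ((n + k <= 2 * N)%nat -> flat k n (cos_rem N)) /\
  ((n + k <= 2 * N + 1)%nat -> flat k n (sin_rem N)).
Proof.
  assert (B : forall N, bigO (2 * N) (cos_rem N) /\ bigO (2 * N + 1) (sin_rem N)).
  { intros N. destruct (sin_cos_rem_bound N) as (M & d & HM & Hd & H).
    split; exists M, d; (split; [exact HM|]); (split; [exact Hd|]); intros z _ Hz; now apply H. }
  induction k as [|k IH]; intros N n; (split; intros L; (split;
    [eapply bigO_le; [exact L | now apply B] |])); trivial.
  - destruct N as [|N]; [lia|]. exists (fun z => (- (1)) * sin_rem N z)%C. split.
    + intros z _. apply is_Cderive_eq_val with (2 := is_Cderive_cos_rem N z). ring.
    + apply flat_scal. apply IH. lia.
  - exists (cos_rem N). split. intros; apply is_Cderive_sin_rem. apply IH. lia.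
Qed.

(** * The spherical Bessel functions near the origin *)

(** One application of Rayleigh's operator uses up one controlled derivative of the remainder, and
    its division by z costs one order. *)
Lemma rayleigh_step (f A A' r : C -> C) (k n : nat) :
  (forall z : C, z <> 0%C -> f z = (A z + r z)%C) ->
  (forall z : C, z <> 0%C -> is_Cderive A z (A' z)) ->
  flat (S k) (S n) r ->
  exists s, flat k n s /\
    forall z : C, z <> 0%C -> rayleigh_op f z = (A' z / z + s z)%C.
Proof.
  intros E D [B (r' & Dr & H)]. exists (fun z => r' z / z)%C. split.
  now apply flat_div.
  intros z Hz. unfold rayleigh_op.
  rewrite (C_derive_eq f z (A' z + r' z)%C). now field.
  apply is_Cderive_ext with (fun z => A z + r z)%C; trivial.
  intros w Hw. now rewrite E. apply is_Cderive_plus; auto.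
Qed.

(** The term 2i in the hypothesis pays for one derivative and one order per application. The
    constant term is differentiated away each time, which shortens the list to [N - i]. *)
Lemma rayleigh_sinc (i : nat) : forall k n N : nat, (k + n + 2 * i <= 2 * N)%nat ->
  exists r, flat k n r /\ forall z : C, z <> 0%C ->
    Nat.iter i rayleigh_op (fun w => Csin w / w)%C z
    = (peval (coeffs (j_coeff i) (N - i)) (z * z) + r z)%C.
Proof.
  induction i as [|i IH]; intros k n N L.
  - exists (fun z => sin_rem N z / z)%C. split.
    + apply flat_div. apply flat_sin_cos_rem. lia.
    + intros z Hz. simpl. rewrite Nat.sub_0_r. unfold sin_rem. now field.
  - destruct (IH (S k) (S n) N ltac:(lia)) as (r & Hr & E).
    destruct (rayleigh_step _ _ _ r k n E (fun z _ => is_Cderive_peval_sqr _ z) Hr) as (s & Hs & F).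
    exists s. split; trivial. intros z Hz. simpl Nat.iter. rewrite F by trivial. f_equal.
    destruct (N - i)%nat as [|m] eqn:Em.
    + replace (N - S i)%nat with 0%nat by lia. simpl. now field.
    + replace (N - S i)%nat with m by lia. simpl tl.
      rewrite euler_op_coeffs, (coeffs_ext _ _ _ (j_coeff_shift i)). now field.
Qed.

(** Coefficients of the i-fold image of cos z / z after the factor z^-(2i+1). The exponents are odd,
    so no coefficient is annihilated and the list keeps its length. *)
Fixpoint cos_list (N i : nat) : list R :=
  match i with
  | O => coeffs cos_coeff N
  | S i' => euler_op (- INR (2 * i' + 1)) (cos_list N i')
  end.

Lemma rayleigh_cosc (i : nat) : forall k n N : nat, (k + n + 2 * i + 1 <= 2 * N)%nat ->
  exists r, flat k n r /\ forall z : C, z <> 0%C ->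
    Nat.iter i rayleigh_op (fun w => Ccos w / w)%C z
    = (/ z ^ (2 * i + 1) * peval (cos_list N i) (z * z) + r z)%C.
Proof.
  induction i as [|i IH]; intros k n N L.
  - exists (fun z => cos_rem N z / z)%C. split.
    + apply flat_div. apply flat_sin_cos_rem. lia.
    + intros z Hz. simpl. unfold cos_rem. now field.
  - destruct (IH (S k) (S n) N ltac:(lia)) as (r & Hr & E).
    destruct (rayleigh_step _ _ _ r k n E
                (fun z Hz => is_Cderive_invpow_peval _ _ z Hz) Hr) as (s & Hs & F).
    exists s. split; trivial. intros z Hz. simpl Nat.iter. rewrite F by trivial. f_equal.
    simpl cos_list. replace (2 * S i + 1)%nat with (S (S (2 * i + 1))) by lia.
    assert (P := Cpow_nz z (2 * i + 1) Hz).
    rewrite !Cpow_S. change (i + (i + 0) + 1)%nat with (2 * i + 1)%nat. now field.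
Qed.

(* [psi_l(z) ~ z^(l+1) A(z^2)] and [z y_l(z) ~ z^(-l) B(z^2)]. *)
Definition psi_list (l : nat) : list R := coeffs (fun k => (-1) ^ l * j_coeff l k) (l + 1).

Definition chi_list (l : nat) : list R :=
  map (Rmult (- (-1) ^ l)) (cos_list (l + 1) l).

Lemma peval_map_scal (c : R) (L : list R) (u : C) :
  peval (map (Rmult c) L) u = (RtoC c * peval L u)%C.
Proof. induction L as [|r t IH]; simpl. ring. rewrite IH, RtoC_mult. ring. Qed.

Lemma Copp_pow (z : C) (l : nat) : ((- z) ^ l)%C = (RtoC ((-1) ^ l) * z ^ l)%C.
Proof.
  rewrite RtoC_pow. replace (- z)%C with (RtoC (-1) * z)%C.
  apply Cpow_mult_l. ring.
Qed.

Lemma psi_expansion (l : nat) :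
  exists r r' : C -> C, bigO (3 * l + 3) r /\ bigO (3 * l + 2) r' /\
    forall z : C, z <> 0%C ->
      psi l z = (z ^ (l + 1) * peval (psi_list l) (z * z) + r z)%C /\
      is_Cderive (psi l) z
        (z ^ l * peval (euler_op (INR (l + 1)) (psi_list l)) (z * z) + r' z)%C.
Proof.
  (* One derivative is kept for psi_l'. The choice of N leaves l + 1 coefficients, so the relative
     error is of order 2l + 2. *)
  destruct (rayleigh_sinc l 1 (2 * l + 1) (2 * l + 1) ltac:(lia)) as (r0 & H0 & E0).
  assert (H := flat_scal _ _ (RtoC ((-1) ^ l)) _ (flat_mult_pow (S l) _ _ _ H0)).
  set (r := fun z => (RtoC ((-1) ^ l) * (z ^ S l * r0 z))%C) in H.
  assert (E : forall z : C, z <> 0%C ->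
    (z ^ S l * peval (psi_list l) (z * z) + r z)%C = psi l z).
  { intros z Hz. unfold psi, sph_j. rewrite E0, Copp_pow by trivial. unfold psi_list, r.
    replace (2 * l + 1 - l)%nat with (l + 1)%nat by lia.
    rewrite peval_coeffs_scal. simpl Cpow. ring. }
  destruct H as [B (r' & D & H)]. apply flat_bigO in H.
  exists r, r'. split; [|split].
  - now replace (3 * l + 3)%nat with (S l + (2 * l + 1) + 1)%nat by lia.
  - now replace (3 * l + 2)%nat with (S l + (2 * l + 1) + 0)%nat by lia.
  - intros z Hz. rewrite Nat.add_1_r. split.
    + now rewrite E.
    + apply is_Cderive_ext with (2 := E); trivial.
      apply (is_Cderive_plus (fun z => z ^ S l * peval (psi_list l) (z * z))%C).
      apply is_Cderive_pow_peval. now apply D.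
Qed.

Lemma chi_expansion (l : nat) :
  exists r r' : C -> C, bigO (l + 2) r /\ bigO (l + 1) r' /\
    forall z : C, z <> 0%C ->
      (z * sph_y l z)%C = (/ z ^ l * peval (chi_list l) (z * z) + r z)%C /\
      is_Cderive (fun w => w * sph_y l w)%C z
        (/ z ^ S l * peval (euler_op (- INR l) (chi_list l)) (z * z) + r' z)%C.
Proof.
  (* The remainder has order only 1, but the main term starts at z^-(2l+1), so the relative error is
     again of order 2l + 2. *)
  destruct (rayleigh_cosc l 1 0 (l + 1) ltac:(lia)) as (r0 & H0 & E0).
  assert (H := flat_scal _ _ (RtoC (- (-1) ^ l)) _ (flat_mult_pow (S l) _ _ _ H0)).
  set (r := fun z => (RtoC (- (-1) ^ l) * (z ^ S l * r0 z))%C) in H.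
  assert (E : forall z : C, z <> 0%C ->
    (/ z ^ l * peval (chi_list l) (z * z) + r z)%C = (z * sph_y l z)%C).
  { intros z Hz. unfold sph_y. rewrite E0, Copp_pow by trivial. unfold chi_list, r.
    rewrite peval_map_scal, RtoC_opp.
    replace (2 * l + 1)%nat with (l + S l)%nat by lia. rewrite Cpow_add_r.
    simpl Cpow. assert (P := Cpow_nz z l Hz). field. auto. }
  destruct H as [B (r' & D & H)]. apply flat_bigO in H.
  exists r, r'. split; [|split].
  - now replace (l + 2)%nat with (S l + 0 + 1)%nat by lia.
  - now replace (l + 1)%nat with (S l + 0 + 0)%nat by lia.
  - intros z Hz. split.
    + now rewrite E.
    + apply is_Cderive_ext with (2 := E); trivial.
      apply (is_Cderive_plus (fun z => / z ^ l * peval (chi_list l) (z * z))%C).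
      now apply is_Cderive_invpow_peval. now apply D.
Qed.

(** * Cancellation of factors and orders of polynomials *)

Lemma bigO_mult_l (n : nat) (f g : C -> C) :
  bigO n f -> bigO 0 g -> bigO n (fun z => f z * g z)%C.
Proof. intros H K. rewrite <- (Nat.add_0_r n). now apply bigO_mult. Qed.

Lemma bigO_mult_r (n : nat) (f g : C -> C) :
  bigO 0 f -> bigO n g -> bigO n (fun z => f z * g z)%C.
Proof. apply (bigO_mult 0 n). Qed.

Lemma bigO_any_0 (n : nat) (f : C -> C) : bigO n f -> bigO 0 f.
Proof. apply bigO_le. lia. Qed.

Lemma bigO_const_eq_0 (c : C) : bigO 1 (fun _ => c) -> c = 0%C.
Proof.
  intros (M & d & HM & Hd & H). apply Cmod_eq_0.
  destruct (Req_dec (Cmod c) 0) as [E|N]; trivial. exfalso.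
  assert (X := Cmod_ge_0 c).
  (* At this test point M t is at most |c|/2, contradicting |c| <= M t. *)
  set (t := Rmin (d / 2) (Cmod c / (2 * M))).
  assert (Ht : 0 < t) by (apply Rmin_pos; [lra | apply Rdiv_lt_0_compat; lra]).
  assert (T1 : t <= d / 2) by apply Rmin_l.
  assert (T2 : t <= Cmod c / (2 * M)) by apply Rmin_r.
  assert (Et : Cmod (RtoC t) = t) by (rewrite Cmod_R; apply Rabs_pos_eq; lra).
  specialize (H (RtoC t)). rewrite Et, pow_1 in H.
  assert (K := H ltac:(intros E; apply RtoC_inj in E; lra) ltac:(lra)).
  apply (Rmult_le_compat_l M) in T2; [|lra].
  replace (M * (Cmod c / (2 * M))) with (Cmod c / 2) in T2 by (field; lra). lra.
Qed.

(** Near the origin |c + k z| is at least |c|/2. This converts a small residue of the dispersion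
    relation into a small error of its solution. *)
Lemma bigO_cancel (n : nat) (c : C) (f k : C -> C) :
  c <> 0%C -> bigO 1 k -> bigO n (fun z => f z * (c + k z))%C -> bigO n f.
Proof.
  intros Hc (M & d & HM & Hd & H) (M' & d' & HM' & Hd' & H').
  assert (P := proj1 (Cmod_gt_0 c) Hc).
  exists (M' * (2 / Cmod c)), (Rmin (Rmin d d') (Cmod c / (2 * M))).
  split. apply Rmult_lt_0_compat; trivial. apply Rdiv_lt_0_compat; lra.
  split. apply Rmin_pos; [now apply Rmin_pos|]. apply Rdiv_lt_0_compat; lra.
  intros z Hz B.
  assert (B1 := Rlt_le_trans _ _ _ B (Rmin_l _ _)).
  assert (B2 := Rlt_le_trans _ _ _ B (Rmin_r _ _)).
  specialize (H z Hz (Rlt_le_trans _ _ _ B1 (Rmin_l _ _))).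
  specialize (H' z Hz (Rlt_le_trans _ _ _ B1 (Rmin_r _ _))).
  rewrite pow_1 in H. rewrite Cmod_mult in H'.
  apply (Rmult_lt_compat_l M) in B2; [|lra].
  replace (M * (Cmod c / (2 * M))) with (Cmod c / 2) in B2 by (field; lra).
  assert (T : Cmod c / 2 <= Cmod (c + k z)%C).
  { assert (T := Cmod_triangle (c + k z) (- k z)). rewrite Cmod_opp in T.
    replace (c + k z + - k z)%C with c in T by ring. lra. }
  assert (X := Cmod_ge_0 (f z)).
  apply Rmult_le_reg_r with (Cmod c / 2); [lra|].
  replace (M' * (2 / Cmod c) * Cmod z ^ n * (Cmod c / 2)) with (M' * Cmod z ^ n) by (field; lra).
  apply Rle_trans with (2 := H'). now apply Rmult_le_compat_l.
Qed.

Lemma bigO_peval (L : list R) (v : C -> C) : bigO 0 v -> bigO 0 (fun z => peval L (v z)).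
Proof.
  intros H. induction L as [|r t IH]; simpl. apply bigO_0.
  apply (bigO_plus 0 (fun _ => RtoC r)). apply bigO_const. now apply bigO_mult_l.
Qed.

Lemma bigO_peval_tail (r : R) (t : list R) (v : C -> C) (n : nat) :
  bigO n v -> bigO n (fun z => peval (r :: t) (v z) - RtoC r)%C.
Proof.
  intros H. apply bigO_ext with (fun z => v z * peval t (v z))%C.
  - intros; simpl; ring.
  - apply bigO_mult_l; trivial. apply bigO_peval. now apply bigO_any_0 with n.
Qed.

(* Divided difference of the polynomial [L]. *)
Fixpoint pdiff (L : list R) (x y : C) : C :=
  match L with
  | [] => 0%C
  | _ :: t => (peval t x + y * pdiff t x y)%C
  end.

Lemma peval_minus (L : list R) (x y : C) :
  (peval L x - peval L y = (x - y) * pdiff L x y)%C.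
Proof.
  induction L as [|r t IH]; simpl. ring.
  replace (RtoC r + x * peval t x - (RtoC r + y * peval t y))%C
    with ((x - y) * peval t x + y * (peval t x - peval t y))%C by ring.
  rewrite IH. ring.
Qed.

Lemma bigO_pdiff (L : list R) (v w : C -> C) :
  bigO 0 v -> bigO 0 w -> bigO 0 (fun z => pdiff L (v z) (w z)).
Proof.
  intros H K. induction L as [|r t IH]; simpl. apply bigO_0.
  apply bigO_plus. now apply bigO_peval. now apply bigO_mult_l.
Qed.

(** * The reduced dispersion relation *)

(* With [eta = eps / epsb] and [w = xb^2], so that [x^2 = eta w]. *)
Definition dispersion (A1 A2 : list R) (m1 m2 eta w : C) : C :=
  (peval A2 (eta * w) * m1 - eta * peval A1 (eta * w) * m2)%C.

(** Changing [eta] moves the argument eta w only by a multiple of w, which is small; what remains at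
    leading order is the explicit factor [eta], with coefficient - A1(0) m2(0). The lemma serves the
    formal solution, the correction in s and the final comparison alike. *)
Lemma dispersion_minus (a0 : R) (A1 A2 : list R) (c2 : C) (m1 m2 eta eta' w : C -> C) :
  bigO 1 w -> bigO 0 m1 -> bigO 1 (fun z => m2 z - c2)%C -> bigO 0 eta -> bigO 0 eta' ->
  exists k, bigO 1 k /\ forall z,
    (dispersion (a0 :: A1) A2 (m1 z) (m2 z) (eta z) (w z)
     - dispersion (a0 :: A1) A2 (m1 z) (m2 z) (eta' z) (w z)
     = (eta z - eta' z) * (- (RtoC a0 * c2) + k z))%C.
Proof.
  intros Hw H1 H2 He He'.
  assert (Hm : bigO 0 m2).
  { apply bigO_ext with (fun z => (m2 z - c2) + c2)%C. intros; ring.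
    apply bigO_plus. now apply bigO_any_0 with 1%nat. apply bigO_const. }
  assert (Hx : bigO 1 (fun z => eta z * w z)%C) by now apply bigO_mult_r.
  assert (Hx' : bigO 1 (fun z => eta' z * w z)%C) by now apply bigO_mult_r.
  assert (Kx := bigO_any_0 _ _ Hx). assert (Kx' := bigO_any_0 _ _ Hx').
  exists (fun z => w z * (pdiff A2 (eta z * w z) (eta' z * w z) * m1 z)
    - (eta' z * w z) * (pdiff (a0 :: A1) (eta z * w z) (eta' z * w z) * m2 z)
    - (RtoC a0 * (m2 z - c2))
    - (eta z * w z) * (peval A1 (eta z * w z) * m2 z))%C.
  split.
  - apply bigO_minus; [apply bigO_minus; [apply bigO_minus|]|].
    + apply bigO_mult_l; trivial. apply bigO_mult_l; trivial. now apply bigO_pdiff.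
    + apply bigO_mult_l; trivial. apply bigO_mult_l; trivial. now apply bigO_pdiff.
    + now apply bigO_scal.
    + apply bigO_mult_l; trivial. apply bigO_mult_l; trivial. now apply bigO_peval.
  - intros z. unfold dispersion.
    assert (E2 := peval_minus A2 (eta z * w z) (eta' z * w z)).
    assert (E1 := peval_minus (a0 :: A1) (eta z * w z) (eta' z * w z)).
    set (x := (eta z * w z)%C) in *. set (y := (eta' z * w z)%C) in *.
    replace (peval A2 x * m1 z - eta z * peval (a0 :: A1) x * m2 z
      - (peval A2 y * m1 z - eta' z * peval (a0 :: A1) y * m2 z))%C
      with ((peval A2 x - peval A2 y) * m1 z - (eta z - eta' z) * peval (a0 :: A1) x * m2 z
        - eta' z * (peval (a0 :: A1) x - peval (a0 :: A1) y) * m2 z)%C by ring.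
    rewrite E1, E2. change (peval (a0 :: A1) x) with (RtoC a0 + x * peval A1 x)%C.
    set (D1 := pdiff (a0 :: A1) x y). set (D2 := pdiff A2 x y). set (P := peval A1 x).
    unfold x, y. ring.
Qed.

(** * Polynomial arithmetic and the formal solution *)

Lemma peval_app_one (L : list R) (c : R) (u : C) :
  peval (L ++ [c]) u = (peval L u + RtoC c * u ^ length L)%C.
Proof. induction L as [|r t IH]; simpl. ring. rewrite IH. ring. Qed.

Fixpoint padd (L M : list R) : list R :=
  match L, M with
  | [], _ => M
  | _, [] => L
  | a :: L', b :: M' => a + b :: padd L' M'
  end.

Fixpoint pmul (L M : list R) : list R :=
  match L with
  | [] => []
  | a :: L' => padd (map (Rmult a) M) (0 :: pmul L' M)
  end.

Fixpoint pcomp (L M : list R) : list R :=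
  match L with
  | [] => []
  | a :: L' => padd [a] (pmul M (pcomp L' M))
  end.

Lemma peval_padd (L : list R) : forall (M : list R) (u : C),
  peval (padd L M) u = (peval L u + peval M u)%C.
Proof.
  induction L as [|a L IH]; intros [|b M] u; simpl; try ring.
  rewrite IH, RtoC_plus. ring.
Qed.

Lemma peval_pmul (L M : list R) (u : C) : peval (pmul L M) u = (peval L u * peval M u)%C.
Proof.
  induction L as [|a L IH]. simpl; ring.
  simpl pmul. rewrite peval_padd, peval_map_scal. simpl peval. rewrite IH. ring.
Qed.

Lemma peval_pcomp (L M : list R) (u : C) : peval (pcomp L M) u = peval L (peval M u).
Proof.
  induction L as [|a L IH]; trivial.
  change (pcomp (a :: L) M) with (padd [a] (pmul M (pcomp L M))).
  rewrite peval_padd, peval_pmul, IH. simpl peval. ring.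
Qed.

(** [0 :: L] represents u L(u), the argument eta w. The residue thus becomes a polynomial, with
    coefficients that can be read off and cancelled. *)
Definition dispersion_poly (A1 A2 B1 B2 L : list R) : list R :=
  padd (pmul (pcomp A2 (0 :: L)) B1)
       (map (Rmult (-1)) (pmul (pmul L (pcomp A1 (0 :: L))) B2)).

Lemma peval_dispersion_poly (A1 A2 B1 B2 L : list R) (u : C) :
  peval (dispersion_poly A1 A2 B1 B2 L) u
  = dispersion A1 A2 (peval B1 u) (peval B2 u) (peval L u) u.
Proof.
  unfold dispersion_poly, dispersion.
  rewrite peval_padd, peval_map_scal, !peval_pmul, !peval_pcomp. simpl.
  replace (0 + u * peval L u)%C with (peval L u * u)%C by ring. ring.
Qed.

(** For polynomials the analytic order of vanishing is divisibility by a power of u; this exposes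
    the coefficient that the next correction has to remove. *)
Lemma bigO_peval_factor (k : nat) : forall T : list R,
  bigO k (peval T) -> exists T' : list R, forall u : C, peval T u = (u ^ k * peval T' u)%C.
Proof.
  induction k as [|k IH]; intros T H.
  - exists T. intros; simpl; ring.
  - destruct T as [|r t]. { exists []. intros; simpl; ring. }
    assert (r0 : RtoC r = 0%C).
    { apply bigO_const_eq_0.
      apply bigO_ext with (fun z => peval (r :: t) z - (peval (r :: t) z - RtoC r))%C.
      intros; ring. apply bigO_minus. apply bigO_le with (2 := H); lia.
      apply (bigO_peval_tail r t (fun z => z)), bigO_id. }
    destruct (IH t) as [T' E].
    { apply bigO_ext with (fun z => peval (r :: t) z / z)%C.
      - intros z Hz. simpl. rewrite r0. now field.
      - now apply bigO_div. }
    exists T'. intros u. simpl. rewrite r0, E. ring.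
Qed.

Lemma bigO_peval_cons (k : nat) (r : R) (t : list R) :
  r = 0 -> bigO k (peval t) -> bigO (S k) (peval (r :: t)).
Proof.
  intros -> H. apply bigO_ext with (fun z => z * peval t z)%C. intros; simpl; ring.
  apply (bigO_mult 1 k (fun z => z)); trivial. apply bigO_id.
Qed.

Lemma bigO_peval_root_0 (T : list R) : peval T 0 = 0%C -> bigO 1 (peval T).
Proof.
  destruct T as [|r t]; intros E.
  - apply bigO_0.
  - simpl in E. assert (E' : RtoC r = 0%C) by (rewrite <- E; ring).
    apply bigO_ext with (fun z => peval (r :: t) z - RtoC r)%C.
    intros z _. rewrite E'. ring. apply (bigO_peval_tail _ _ (fun z => z)), bigO_id.
Qed.

(* Newton iteration on the coefficients of a formal solution. *)
Lemma formal_solution (a0 p0 b0 q0 eta0 : R) (A1 A2 B1 B2 : list R) (n : nat) :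
  a0 * q0 <> 0 -> p0 * b0 = eta0 * a0 * q0 ->
  exists t : list R, length t = n /\
    bigO (S n) (peval (dispersion_poly (a0 :: A1) (p0 :: A2) (b0 :: B1) (q0 :: B2) (eta0 :: t))).
Proof.
  intros Hne H0. induction n as [|n IH].
  - exists []. split; trivial.
    apply bigO_peval_root_0. rewrite peval_dispersion_poly. unfold dispersion; simpl.
    assert (E : (RtoC p0 * RtoC b0 = RtoC eta0 * RtoC a0 * RtoC q0)%C)
      by (rewrite <- !RtoC_mult; now f_equal).
    ring [E].
  - destruct IH as (t & Ht & H).
    destruct (bigO_peval_factor _ _ H) as [T' ET].
    (* [h] is the coefficient of u^(n+1) in the residue, with default 0 for an empty quotient.
       Adding c u^(n+1) to the solution changes that coefficient by - c a0 q0, which fixes [c]. *)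
    set (h := hd 0 T').
    set (c := h / (a0 * q0)).
    exists (t ++ [c]). split. rewrite length_app, Ht; simpl; lia.
    set (L := eta0 :: t) in *. set (L' := eta0 :: t ++ [c]).
    assert (EL : forall u, peval L' u = (peval L u + RtoC c * u ^ S n)%C).
    { intros u. change L' with (L ++ [c]). rewrite peval_app_one. simpl length. now rewrite Ht. }
    assert (Hid := bigO_any_0 _ _ bigO_id).
    destruct (dispersion_minus a0 A1 (p0 :: A2) (RtoC q0)
      (peval (b0 :: B1)) (peval (q0 :: B2)) (peval L') (peval L) (fun z => z))
      as (k & Hk & E).
    + apply bigO_id.
    + now apply (bigO_peval _ (fun z => z)).
    + apply (bigO_peval_tail _ _ (fun z => z)), bigO_id.
    + now apply (bigO_peval _ (fun z => z)).
    + now apply (bigO_peval _ (fun z => z)).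
    + apply bigO_ext with (fun z => z ^ S n * (peval T' z - RtoC h + RtoC c * k z))%C.
      * intros z _. specialize (E z). rewrite <- !peval_dispersion_poly, ET, EL in E.
        match goal with |- _ = ?r => set (X := r) in * end.
        replace X with (X - z ^ S n * peval T' z + z ^ S n * peval T' z)%C by ring.
        rewrite E.
        assert (Eh : RtoC h = (RtoC c * (RtoC a0 * RtoC q0))%C).
        { rewrite <- !RtoC_mult. f_equal. unfold c. field. split; intros Z; apply Hne; rewrite Z; ring. }
        rewrite Eh. ring.
      * replace (S (S n)) with (S n + 1)%nat by lia.
        apply bigO_mult. apply bigO_pow. apply bigO_plus; [|now apply bigO_scal].
        unfold h. destruct T' as [|h' t'].
        { apply bigO_ext with (2 := bigO_0 1). intros; simpl; ring. }
        apply (bigO_peval_tail _ _ (fun z => z)), bigO_id.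
Qed.

(** * Leading coefficients and the principal root *)

Lemma pow_m1_sqr (l : nat) : (-1) ^ l * (-1) ^ l = 1.
Proof. rewrite <- Rpow_mult_distr. replace (-1 * -1) with 1 by ring. apply pow1. Qed.

Lemma psi_list_cons (l : nat) : exists t, psi_list l = / odd_fact (l + 1) :: t.
Proof.
  unfold psi_list. rewrite Nat.add_1_r. eexists. simpl. f_equal.
  unfold j_coeff. simpl plus. rewrite Nat.add_0_r, Nat.add_1_r. simpl (fact 0). simpl.
  assert (H := odd_fact_pos (S l)). assert (P := pow_m1_sqr l).
  replace ((-1) ^ l * ((-1) ^ l / (1 * 1 * odd_fact (S l))))
    with ((-1) ^ l * (-1) ^ l * / odd_fact (S l)) by (field; lra).
  rewrite P. ring.
Qed.

(** The Rayleigh steps multiply the leading coefficient of cos z / z by -1, -3, ..., -(2l-1) in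
    turn. *)
Lemma chi_list_cons (l : nat) : exists t, chi_list l = - odd_fact l :: t.
Proof.
  assert (H : forall i, exists t, cos_list (l + 1) i = (-1) ^ i * odd_fact i :: t).
  { induction i as [|i [t IH]].
    - rewrite Nat.add_1_r. eexists. simpl. f_equal. unfold cos_coeff, odd_fact. simpl. field.
    - simpl cos_list. rewrite IH. eexists. simpl euler_op. f_equal.
      change (i + (i + 0) + 1)%nat with (2 * i + 1)%nat.
      rewrite odd_fact_S, plus_INR, mult_INR. simpl. ring. }
  destruct (H l) as [t E]. unfold chi_list. rewrite E. eexists. simpl. f_equal.
  rewrite <- Rmult_assoc. rewrite <- (Ropp_mult_distr_l ((-1) ^ l)), pow_m1_sqr. ring.
Qed.

(** The product of the two real roots is |b|/2, and the sign factor in [Csqrt] turns |b| into b. *)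
Lemma Csqrt_sqr (z : C) : (Csqrt z * Csqrt z = z)%C.
Proof.
  destruct z as [a b]. unfold Csqrt, Cmult. cbn [fst snd Re Im].
  set (m := Cmod (a, b)).
  assert (Hm := re_le_Cmod (a, b)). simpl in Hm. fold m in Hm.
  assert (M2 : m * m = a * a + b * b).
  { unfold m, Cmod. simpl. rewrite sqrt_sqrt. ring. nra. }
  clearbody m. apply Rabs_le_between in Hm.
  assert (S1 : sqrt ((m + a) / 2) * sqrt ((m + a) / 2) = (m + a) / 2) by (apply sqrt_sqrt; lra).
  assert (S2 : sqrt ((m - a) / 2) * sqrt ((m - a) / 2) = (m - a) / 2) by (apply sqrt_sqrt; lra).
  assert (S3 : sqrt ((m + a) / 2) * sqrt ((m - a) / 2) = Rabs b / 2).
  { rewrite <- sqrt_mult by lra.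
    replace ((m + a) / 2 * ((m - a) / 2)) with (Rsqr (b / 2)) by (unfold Rsqr; nra).
    rewrite sqrt_Rsqr_abs. unfold Rdiv. rewrite Rabs_mult, (Rabs_pos_eq (/ 2)); lra. }
  set (p := sqrt ((m + a) / 2)) in *. set (q := sqrt ((m - a) / 2)) in *. clearbody p q.
  destruct (Rle_dec 0 b) as [Hb|Hb].
  - rewrite Rabs_pos_eq in S3 by lra. f_equal; nra.
  - rewrite Rabs_left in S3 by lra. f_equal; nra.
Qed.

Lemma Csqrt_neq_0 (z : C) : z <> 0%C -> Csqrt z <> 0%C.
Proof. intros H E. apply H. rewrite <- (Csqrt_sqr z), E. ring. Qed.

Lemma filterlim_Cmod (f : C -> C) (l : C) (e : R) :
  filterlim f (locally' (RtoC 0)) (locally l) -> 0 < e ->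
  exists d, 0 < d /\ forall z : C, z <> 0%C -> Cmod z < d -> Cmod (f z - l)%C < e.
Proof.
  intros H He. apply locally'_Cmod. apply (H (fun w => Cmod (w - l)%C < e)).
  assert (Hd' : 0 < e / sqrt 2) by (apply Rdiv_lt_0_compat; trivial; apply Rlt_sqrt2_0).
  exists (mkposreal _ Hd'). intros w B.
  apply C_NormedModule_mixin_compat2 in B.
  replace e with (sqrt 2 * (e / sqrt 2)). exact B.
  field. apply Rgt_not_eq, Rlt_sqrt2_0.
Qed.

(** * Expansion of the plasmonic singularity *)

(** Residue of the dispersion relation with s set to zero, that is with y_l in the role of the
    Hankel function up to a constant factor. *)
Definition reduced_poly (l : nat) (L : list R) : list R :=
  dispersion_poly (psi_list l) (euler_op (INR (l + 1)) (psi_list l))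
    (chi_list l) (euler_op (- INR l) (chi_list l)) L.

Lemma factors_of_zero (c x y a p q e e' : C) : c <> 0%C -> e <> 0%C ->
  (c * (Ci * x * y * a * e - Ci * p * q * e') = 0)%C -> (a * (x * y) = e' / e * (p * q))%C.
Proof.
  intros Hc He H. apply Ceq_minus.
  replace (a * (x * y) - e' / e * (p * q))%C
    with (/ c * / Ci * / e * (c * (Ci * x * y * a * e - Ci * p * q * e')))%C.
  rewrite H. ring. field. auto using Ci_nz.
Qed.

Lemma xi_derive_factor (x y a b c d : C) : x <> 0%C -> y <> 0%C ->
  (x * y * (y * a + c + Ci * (/ (x * y) * b + d))
   = x * y * y * a + Ci * b + x * y * (c + Ci * d))%C.
Proof. intros Hx Hy. now field. Qed.

(** The formal solution enters as an arbitrary list with small residue, so that the solution from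
    Newton iteration and the explicit lists for l = 1, 2 are treated together. *)
Lemma plasmonic_expansion (l : nat) (t : list R) (epsb : C) (ep : C -> C) :
  (1 <= l)%nat -> bigO (S l) (peval (reduced_poly l (- ((INR l + 1) / INR l) :: t))) ->
  epsb <> 0%C -> plasmonic_singularity l epsb ep ->
  bigO (2 * l + 2) (fun z => ep z -
    (epsb * peval (- ((INR l + 1) / INR l) :: t)%R (epsb * z ^ 2)
     - Ci * z ^ (2 * l + 1) * epsb ^ (l + 1) * Csqrt epsb
       * RtoC ((INR l + 1) / INR l ^ 2) * RtoC (1 / odd_fact l ^ 2)))%C.
Proof.
  intros Hl HP Hb [Hlim Hzero].
  set (eta0 := - ((INR l + 1) / INR l)) in *.
  assert (Hl1 : 1 <= INR l) by (now apply (le_INR 1)).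
  set (sb := Csqrt epsb). assert (Hsb := Csqrt_sqr epsb). fold sb in Hsb.
  assert (Hsb0 : sb <> 0%C) by now apply Csqrt_neq_0.
  destruct (psi_expansion l) as (r & r' & Hr & Hr' & Epsi).
  destruct (chi_expansion l) as (q & q' & Hq & Hq' & Echi).
  set (A1 := psi_list l) in *. set (A2 := euler_op (INR (l + 1)) A1) in *.
  set (B1 := chi_list l) in *. set (B2 := euler_op (- INR l) B1) in *.
  assert (Hst : static_resonance l epsb <> 0%C).
  { unfold static_resonance. intros E. apply Hb.
    assert (P : 0 < (INR l + 1) / INR l) by (apply Rdiv_lt_0_compat; lra).
    assert (E' : (RtoC ((INR l + 1) / INR l) * epsb = 0)%C)
      by (rewrite <- (Copp_0), <- E; ring).
    destruct (Req_dec (Cmod epsb) 0) as [Z|Z]. now apply Cmod_eq_0.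
    exfalso. apply (f_equal Cmod) in E'. rewrite Cmod_mult, Cmod_R, Cmod_0, Rabs_pos_eq in E' by lra.
    apply Rmult_integral in E'. lra. }
  apply Cmod_gt_0 in Hst. set (st := static_resonance l epsb) in *.
  (* The tolerance |st| yields both facts needed about [ep]: it does not vanish, and it is bounded
     by 2 |st|. *)
  destruct (filterlim_Cmod ep st (Cmod st) Hlim Hst) as (d1 & Hd1 & K1).
  apply locally'_Cmod in Hzero. destruct Hzero as (d2 & Hd2 & K2).
  assert (Hep0 : forall z : C, z <> 0%C -> Cmod z < d1 -> ep z <> 0%C).
  { intros z Hz B E. specialize (K1 z Hz B). rewrite E in K1.
    replace (0 - st)%C with (- st)%C in K1 by ring. rewrite Cmod_opp in K1. lra. }
  assert (Hepb : forall z : C, z <> 0%C -> Cmod z < d1 -> Cmod (ep z) <= 2 * Cmod st).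
  { intros z Hz B. specialize (K1 z Hz B). replace (ep z) with (ep z - st + st)%C by ring.
    apply Rle_trans with (1 := Cmod_triangle _ _). lra. }
  set (eta := fun z => (ep z / epsb)%C).
  set (u := fun z : C => (epsb * z ^ 2)%C).
  set (x := fun z : C => (z * Csqrt (ep z))%C).
  set (xb := fun z : C => (z * sb)%C).
  assert (Oeta : bigO 0 eta).
  { apply bigO_ext with (fun z => / epsb * ep z)%C.
    { intros; unfold eta, Cdiv; ring. }
    apply bigO_scal. exists (2 * Cmod st), d1. split; [lra|]. split; trivial.
    intros z Hz B. simpl. rewrite Rmult_1_r. now apply Hepb. }
  assert (Ou2 : bigO 2 u) by apply bigO_scal, bigO_pow.
  assert (Ou : bigO 1 u) by (apply bigO_le with (2 := Ou2); lia).
  assert (Ou0 := bigO_any_0 _ _ Ou).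
  assert (Ox : bigO 1 x).
  { apply (bigO_mult 1 0 (fun z => z) (fun z => Csqrt (ep z)) bigO_id).
    exists (1 + 2 * Cmod st), d1. split; [lra|]. split; trivial.
    intros z Hz B. specialize (Hepb z Hz B).
    assert (E := f_equal Cmod (Csqrt_sqr (ep z))). rewrite Cmod_mult in E.
    assert (X := Cmod_ge_0 (Csqrt (ep z))). simpl. nra. }
  assert (Oxb : bigO 1 xb).
  { apply bigO_ext with (fun z => sb * z)%C. intros; unfold xb; ring. apply bigO_scal, bigO_id. }
  assert (Hx0 : forall z : C, z <> 0%C -> Cmod z < d1 -> x z <> 0%C).
  { intros z Hz B. apply Cmult_neq_0; trivial. apply Csqrt_neq_0. now apply Hep0. }
  assert (Hxb0 : forall z : C, z <> 0%C -> xb z <> 0%C).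
  { intros z Hz. now apply Cmult_neq_0. }
  assert (Exx : forall z, (x z * x z = eta z * u z)%C).
  { intros z. unfold x, eta, u.
    replace (z * Csqrt (ep z) * (z * Csqrt (ep z)))%C
      with (z * z * (Csqrt (ep z) * Csqrt (ep z)))%C by ring.
    rewrite Csqrt_sqr. field. trivial. }
  assert (Exb : forall z, (xb z * xb z = u z)%C).
  { intros z. unfold xb, u. rewrite <- Hsb. ring. }
  (* Remainders relative to the leading powers; all four turn out to have order 2l + 2. *)
  set (rho1 := fun z => (r (x z) / x z ^ (l + 1))%C).
  set (rho2 := fun z => (r' (x z) / x z ^ l)%C).
  set (sg1 := fun z => (xb z ^ l * (r (xb z) + Ci * q (xb z)))%C).
  set (sg2 := fun z => (xb z ^ (l + 1) * (r' (xb z) + Ci * q' (xb z)))%C).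
  assert (comp : forall n (f : C -> C) (v : C -> C) d, 0 < d -> bigO 1 v ->
    (forall z : C, z <> 0%C -> Cmod z < d -> v z <> 0%C) -> bigO n f -> bigO n (fun z => f (v z))).
  { intros n f v d Hd Hv1 Hv2 Hf. rewrite <- (Nat.mul_1_r n). now apply (bigO_comp n 1 f v d). }
  assert (Orho1 : bigO (2 * l + 2) rho1).
  { apply (comp _ (fun w => r w / w ^ (l + 1))%C x d1); trivial. apply bigO_div_pow.
    now replace (2 * l + 2 + (l + 1))%nat with (3 * l + 3)%nat by lia. }
  assert (Orho2 : bigO (2 * l + 2) rho2).
  { apply (comp _ (fun w => r' w / w ^ l)%C x d1); trivial. apply bigO_div_pow.
    now replace (2 * l + 2 + l)%nat with (3 * l + 2)%nat by lia. }
  assert (Osg1 : bigO (2 * l + 2) sg1).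
  { apply (comp _ (fun w => w ^ l * (r w + Ci * q w))%C xb d1); auto.
    replace (2 * l + 2)%nat with (l + (l + 2))%nat by lia.
    apply bigO_mult; [apply bigO_pow|]. apply bigO_plus; [|now apply bigO_scal].
    apply bigO_le with (2 := Hr); lia. }
  assert (Osg2 : bigO (2 * l + 2) sg2).
  { apply (comp _ (fun w => w ^ (l + 1) * (r' w + Ci * q' w))%C xb d1); auto.
    replace (2 * l + 2)%nat with ((l + 1) + (l + 1))%nat by lia.
    apply bigO_mult; [apply bigO_pow|]. apply bigO_plus; [|now apply bigO_scal].
    apply bigO_le with (2 := Hr'); lia. }
  set (s := fun z => (xb z ^ (2 * l + 1))%C).
  assert (Os : bigO (2 * l + 1) s).
  { apply (comp _ (fun w => w ^ (2 * l + 1))%C xb d1); auto. apply bigO_pow. }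
  assert (Os1 : bigO 1 s) by (apply bigO_le with (2 := Os); lia).
  (* i m1 and i m2 are the main parts of xb^l xi_l(xb) and xb^(l+1) xi_l'(xb). The factor s arises
     because j_l exceeds y_l by 2l + 1 powers of xb. *)
  set (m1 := fun z => (peval B1 (u z) - Ci * s z * peval A1 (u z))%C).
  set (m2 := fun z => (peval B2 (u z) - Ci * s z * peval A2 (u z))%C).
  assert (OsA : forall A, bigO 1 (fun z => Ci * s z * peval A (u z))%C).
  { intros A. apply bigO_mult_l. now apply bigO_scal. now apply bigO_peval. }
  set (G := fun e z => dispersion A1 A2 (m1 z) (m2 z) (e z) (u z)).
  assert (Ox2 : bigO 0 (fun z => eta z * u z)%C) by now apply bigO_mult_l.
  (* The exact equation holds with the remainders included, so [G eta] equals a sum of terms each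
     containing one of the [rho] or [sg]. *)
  assert (HG : bigO (2 * l + 2) (G eta)).
  { apply bigO_ext_near with
      (f := fun z => (- Ci * (eta z * peval A1 (eta z * u z) * sg2 z
        + eta z * (Ci * m2 z + sg2 z) * rho1 z
        - peval A2 (eta z * u z) * sg1 z - (Ci * m1 z + sg1 z) * rho2 z))%C)
      (d := Rmin d1 d2).
    - now apply Rmin_pos.
    - intros z Hz B.
      assert (B1' := Rlt_le_trans _ _ _ B (Rmin_l _ _)).
      assert (B2' := Rlt_le_trans _ _ _ B (Rmin_r _ _)).
      specialize (K2 z Hz B2').
      specialize (Hx0 z Hz B1'). specialize (Hxb0 z Hz).
      destruct (Epsi _ Hx0) as [Px Px']. destruct (Epsi _ Hxb0) as [Pb Pb'].
      destruct (Echi _ Hxb0) as [Qb Qb'].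
      rewrite Exx in Px, Px'. rewrite Exb in Pb, Pb', Qb, Qb'.
      apply C_derive_eq in Px'.
      assert (Xb : xi l (xb z) = (psi l (xb z) + Ci * (xb z * sph_y l (xb z)))%C).
      { unfold xi, sph_h1, psi. ring. }
      assert (Xb' := is_Cderive_plus _ _ _ _ _ Pb' (is_Cderive_scal Ci _ _ _ Qb')).
      apply (is_Cderive_eq_fun _ (xi l)) in Xb'.
      2: { intros w. unfold xi, sph_h1, psi. ring. }
      apply C_derive_eq in Xb'. rewrite Pb, Qb in Xb.
      unfold mie_f in K2. fold sb in K2. fold (x z) (xb z) in K2.
      rewrite Px, Px', Xb, Xb' in K2.
      unfold G, dispersion.
      assert (NX := Cpow_nz _ l Hx0). assert (NB := Cpow_nz _ l Hxb0).
      assert (NX' := Cpow_nz _ (l + 1) Hx0).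
      assert (F1 : (/ x z ^ (l + 1) * (x z ^ (l + 1) * peval A1 (eta z * u z) + r (x z))
                    = peval A1 (eta z * u z) + rho1 z)%C).
      { unfold rho1. now field. }
      assert (F2 : (/ x z ^ l * (x z ^ l * peval A2 (eta z * u z) + r' (x z))
                    = peval A2 (eta z * u z) + rho2 z)%C).
      { unfold rho2. now field. }
      assert (Es : s z = (xb z * xb z ^ l * xb z ^ l)%C).
      { unfold s. replace (2 * l + 1)%nat with (S (l + l)) by lia.
        rewrite Cpow_S, Cpow_add_r. ring. }
      assert (Ei : forall a b, (Ci * (a - Ci * s z * b) = s z * b + Ci * a)%C).
      { intros a b. replace (Ci * (a - Ci * s z * b))%C
          with (Ci * a - (Ci * Ci) * s z * b)%C by ring. rewrite Ci_sqr. ring. }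
      assert (F3 : (xb z ^ l * (xb z ^ (l + 1) * peval A1 (u z) + r (xb z)
                      + Ci * (/ xb z ^ l * peval B1 (u z) + q (xb z)))
                    = Ci * m1 z + sg1 z)%C).
      { unfold m1, sg1. rewrite Ei, Es, Nat.add_1_r, Cpow_S. now field. }
      assert (F4 : (xb z ^ (l + 1) * (xb z ^ l * peval A2 (u z) + r' (xb z)
                      + Ci * (/ xb z ^ S l * peval B2 (u z) + q' (xb z)))
                    = Ci * m2 z + sg2 z)%C).
      { unfold m2, sg2. rewrite Ei, Es, Nat.add_1_r, !Cpow_S. now apply xi_derive_factor. }
      assert (Q : ((peval A2 (eta z * u z) + rho2 z) * (Ci * m1 z + sg1 z)
               = eta z * ((peval A1 (eta z * u z) + rho1 z) * (Ci * m2 z + sg2 z)))%C).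
      { rewrite <- F1, <- F2, <- F3, <- F4.
        assert (NC : RtoC ((2 * INR l + 1) / INR l) <> 0%C).
        { intros E. apply RtoC_inj in E.
          assert (P : 0 < (2 * INR l + 1) / INR l) by (apply Rdiv_lt_0_compat; lra). lra. }
        exact (factors_of_zero _ _ _ _ _ _ _ _ NC Hb K2). }
      replace (eta z * peval A1 (eta z * u z) * sg2 z
        + eta z * (Ci * m2 z + sg2 z) * rho1 z
        - peval A2 (eta z * u z) * sg1 z - (Ci * m1 z + sg1 z) * rho2 z)%C
      with (eta z * ((peval A1 (eta z * u z) + rho1 z) * (Ci * m2 z + sg2 z))
        - (peval A2 (eta z * u z) + rho2 z) * (Ci * m1 z + sg1 z)
        + Ci * (peval A2 (eta z * u z) * m1 z - eta z * peval A1 (eta z * u z) * m2 z))%C by ring.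
      rewrite Q.
      set (D := (peval A2 (eta z * u z) * m1 z - eta z * peval A1 (eta z * u z) * m2 z)%C).
      match goal with |- (- Ci * (?a - ?a + Ci * D) = D)%C =>
        replace (- Ci * (a - a + Ci * D))%C with (- (Ci * Ci) * D)%C by ring end.
      rewrite Ci_sqr. ring.
    - assert (Om1 : bigO 0 (fun z => Ci * m1 z + sg1 z)%C).
      { apply bigO_plus; [|now apply bigO_any_0 with (2 * l + 2)%nat].
        apply bigO_scal, bigO_minus. now apply bigO_peval. apply bigO_any_0 with 1%nat, OsA. }
      assert (Om2 : bigO 0 (fun z => Ci * m2 z + sg2 z)%C).
      { apply bigO_plus; [|now apply bigO_any_0 with (2 * l + 2)%nat].
        apply bigO_scal, bigO_minus. now apply bigO_peval. apply bigO_any_0 with 1%nat, OsA. }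
      apply bigO_scal, bigO_minus; [apply bigO_minus; [apply bigO_plus|]|];
        apply bigO_mult_r; trivial.
      + apply bigO_mult_l; trivial. now apply bigO_peval.
      + now apply bigO_mult_l.
      + now apply bigO_peval. }
  set (o := odd_fact l) in *. assert (Ho : 0 < o) by apply odd_fact_pos.
  destruct (psi_list_cons l) as [ta Ea]. fold A1 in Ea.
  destruct (chi_list_cons l) as [tb Eb]. fold B1 o in Eb.
  rewrite Nat.add_1_r, odd_fact_S in Ea. fold o in Ea.
  set (a0 := / ((2 * INR l + 1) * o)) in *.
  set (pl := - (INR l) * - o).
  assert (EB2 : exists t', B2 = pl :: t').
  { unfold B2. rewrite Eb. simpl. now eexists. }
  assert (EA2 : exists t', A2 = INR (l + 1) * a0 :: t').
  { unfold A2. rewrite Ea. simpl. now eexists. }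
  destruct EB2 as [tb2 EB2]. destruct EA2 as [ta2 EA2].
  assert (Om2' : bigO 1 (fun z => m2 z - RtoC pl)%C).
  { apply bigO_ext with (fun z => (peval B2 (u z) - RtoC pl) - Ci * s z * peval A2 (u z))%C.
    intros; unfold m2; ring. apply bigO_minus; trivial.
    rewrite EB2. now apply bigO_peval_tail. }
  assert (Om1 : bigO 0 m1).
  { apply bigO_minus. now apply bigO_peval. now apply bigO_any_0 with 1%nat. }
  set (P := fun z => peval (eta0 :: t) (u z)).
  assert (OP : bigO 0 P) by now apply bigO_peval.
  (* [kap] makes the contributions of order exactly [s] cancel in [G eta1]. *)
  set (kap := (- Ci * RtoC ((INR l + 1) / INR l ^ 2 * (1 / o ^ 2)))%C).
  set (eta1 := fun z => (P z + kap * s z)%C).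
  assert (Oeta1 : bigO 0 eta1).
  { apply bigO_plus; trivial. apply bigO_scal. now apply bigO_any_0 with 1%nat. }
  assert (HG1 : bigO (2 * l + 2) (G eta1)).
  { destruct (dispersion_minus a0 ta A2 (RtoC pl) m1 m2 eta1 P u) as (k & Ok & Ek); trivial.
    rewrite <- Ea in Ek.
    (* The first summand has order l + 1 in u, hence 2l + 2 in z. The second is s times a function
       that vanishes at the origin, because the constant terms have been subtracted by the choice of
       [kap]. *)
    apply bigO_ext with (fun z => peval (reduced_poly l (eta0 :: t)) (u z)
      + s z * (kap * k z - Ci * (peval A2 (P z * u z) * peval A1 (u z)
               - P z * peval A1 (P z * u z) * peval A2 (u z)
               - (RtoC (INR (l + 1) * a0 * a0) - RtoC eta0 * RtoC (INR (l + 1) * a0 * a0)))))%C.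
    - intros z Hz. specialize (Ek z). unfold G.
      apply Ceq_minus in Ek. apply Ceq_minus.
      rewrite <- Copp_0, <- Ek. unfold reduced_poly. rewrite peval_dispersion_poly.
      fold A1 A2 B1 B2 (P z).
      (* Balance of the terms in s at the origin: a0 = 1/(2l+1)!!, the head of A2 is (l+1) a0 and pl
         = l (2l-1)!!. Since 1 - eta0 = (2l+1)/l, the factor 2l + 1 cancels and (l+1)/(l^2
         ((2l-1)!!)^2) remains. *)
      assert (KK : (kap * (RtoC a0 * RtoC pl)
        = - Ci * (RtoC (INR (l + 1) * a0 * a0) - RtoC eta0 * RtoC (INR (l + 1) * a0 * a0)))%C).
      { unfold kap. rewrite <- Cmult_assoc, <- !RtoC_mult, <- RtoC_minus. f_equal. f_equal.
        unfold a0, pl, eta0. rewrite plus_INR. simpl INR. field. lra. }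
      set (D := dispersion A1 A2 (m1 z) (m2 z) (eta1 z) (u z)).
      unfold dispersion at 1 2. unfold m1, m2.
      replace (eta1 z - P z)%C with (kap * s z)%C by (unfold eta1; ring).
      set (KR := (RtoC (INR (l + 1) * a0 * a0) - RtoC eta0 * RtoC (INR (l + 1) * a0 * a0))%C) in *.
      replace (kap * s z * (- (RtoC a0 * RtoC pl) + k z))%C
        with (s z * (- (kap * (RtoC a0 * RtoC pl)) + kap * k z))%C by ring.
      rewrite KK. ring.
    - apply bigO_plus.
      + replace (2 * l + 2)%nat with (S l * 2)%nat by lia.
        apply (bigO_comp (S l) 2 _ u 1); trivial. lia. lra.
        intros z Hz _. apply Cmult_neq_0; trivial. now apply Cpow_nz.
      + replace (2 * l + 2)%nat with (2 * l + 1 + 1)%nat by lia.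
        apply bigO_mult; trivial. apply bigO_minus; [now apply bigO_scal|]. apply bigO_scal.
        assert (OPu : bigO 1 (fun z => P z * u z)%C) by now apply bigO_mult_r.
        assert (OPu0 := bigO_any_0 _ _ OPu).
        set (al := INR (l + 1) * a0) in *.
        assert (Q1 : bigO 1 (fun z => peval A2 (P z * u z) - RtoC al)%C)
          by (rewrite EA2; now apply bigO_peval_tail).
        assert (Q2 : bigO 1 (fun z => peval A1 (u z) - RtoC a0)%C)
          by (rewrite Ea; now apply bigO_peval_tail).
        assert (Q3 : bigO 1 (fun z => peval A1 (P z * u z) - RtoC a0)%C)
          by (rewrite Ea; now apply bigO_peval_tail).
        assert (Q4 : bigO 1 (fun z => peval A2 (u z) - RtoC al)%C)
          by (rewrite EA2; now apply bigO_peval_tail).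
        assert (Q5 : bigO 1 (fun z => P z - RtoC eta0)%C) by now apply bigO_peval_tail.
        apply bigO_ext with (fun z =>
          (peval A2 (P z * u z) - RtoC al) * peval A1 (u z) + RtoC al * (peval A1 (u z) - RtoC a0)
          - ((P z - RtoC eta0) * (peval A1 (P z * u z) * peval A2 (u z))
             + RtoC eta0 * ((peval A1 (P z * u z) - RtoC a0) * peval A2 (u z)
                           + RtoC a0 * (peval A2 (u z) - RtoC al))))%C.
        { intros z _. rewrite !RtoC_mult. ring. }
        apply bigO_minus; apply bigO_plus.
        * apply bigO_mult_l; trivial. now apply bigO_peval.
        * now apply bigO_scal.
        * apply bigO_mult_l; trivial. apply (bigO_mult 0 0); now apply bigO_peval.
        * apply bigO_scal, bigO_plus; [|now apply bigO_scal].
          apply bigO_mult_l; trivial. now apply bigO_peval. }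
  (* [eta] and [eta1] both have residue of order 2l + 2, and the variation of the dispersion
     relation in [eta] has the nonzero leading factor - a0 pl. *)
  assert (Hd : bigO (2 * l + 2) (fun z => eta z - eta1 z)%C).
  { destruct (dispersion_minus a0 ta A2 (RtoC pl) m1 m2 eta eta1 u) as (k & Ok & Ek); trivial.
    apply bigO_cancel with (c := (- (RtoC a0 * RtoC pl))%C) (k := k); trivial.
    - rewrite <- RtoC_mult, <- RtoC_opp. intros E. apply RtoC_inj in E.
      assert (P1 : 0 < a0) by (apply Rinv_0_lt_compat; nra).
      assert (P2 : 0 < pl) by (unfold pl; nra). nra.
    - apply bigO_ext with (fun z => G eta z - G eta1 z)%C; [|now apply bigO_minus].
      intros z _. rewrite <- Ek, <- Ea. reflexivity. }
  apply bigO_ext with (fun z => epsb * (eta z - eta1 z))%C; [|now apply bigO_scal].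
  intros z _. unfold eta1, kap, P.
  assert (Es : s z = (z ^ (2 * l + 1) * epsb ^ l * sb)%C).
  { unfold s, xb. rewrite Cpow_mult_l, <- Hsb, Cpow_mult_l.
    replace (2 * l + 1)%nat with (S (l + l)) by lia. rewrite !Cpow_S, !Cpow_add_r. ring. }
  assert (Ez : (epsb * eta z = ep z)%C) by (unfold eta; now field).
  fold (u z) sb. rewrite <- Ez, Es, (Nat.add_1_r l), (Cpow_S epsb), RtoC_mult. ring.
Qed.

(** * The polynomial factor as a double sum *)

Lemma sum_n_single (N p : nat) (f : nat -> C) :
  (p <= N)%nat -> (forall n, n <> p -> f n = 0%C) -> sum_n f N = f p.
Proof.
  intros L H.
  assert (Z : forall M, (M < p)%nat -> sum_n f M = RtoC 0).
  { induction M as [|M IH]; intros HM.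
    - rewrite sum_O. apply H. lia.
    - rewrite sum_Sn, IH, H by lia. apply Cplus_0_l. }
  induction N as [|N IH].
  - rewrite sum_O. f_equal. lia.
  - rewrite sum_Sn. destruct (Nat.eq_dec p (S N)) as [->|Np].
    + rewrite Z by lia. apply Cplus_0_l.
    + rewrite IH, (H (S N)) by lia. apply Cplus_0_r.
Qed.

Lemma sum_n_even (m : nat) (f : nat -> C) :
  (forall j, Nat.Odd j -> f j = 0%C) -> sum_n f (2 * m) = sum_n (fun k => f (2 * k)%nat) m.
Proof.
  intros H. induction m as [|m IH].
  - simpl. now rewrite !sum_O.
  - replace (2 * S m)%nat with (S (S (2 * m))) by lia.
    rewrite !sum_Sn, IH, (H (S (2 * m))) by (exists m; lia).
    replace (2 * S m)%nat with (S (S (2 * m))) by lia.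
    f_equal. apply Cplus_0_r.
Qed.

Lemma sum_n_Cmult_l (c : C) (f : nat -> C) (m : nat) :
  sum_n (fun k => c * f k)%C m = (c * sum_n f m)%C.
Proof. exact (sum_n_mult_l (K := C_Ring) c f m). Qed.

Lemma sum_n_shift (f : nat -> C) (m : nat) :
  sum_n f (S m) = (f O + sum_n (fun k => f (S k)) m)%C.
Proof.
  induction m as [|m IH].
  - now rewrite sum_Sn, !sum_O.
  - rewrite sum_Sn, IH, (sum_Sn _ m). symmetry. apply Cplus_assoc.
Qed.

Lemma peval_sum_n (m : nat) : forall (t : list R) (w : C), length t = S m ->
  peval t w = sum_n (fun k => RtoC (nth k t 0) * w ^ k)%C m.
Proof.
  induction m as [|m IH]; intros t w Ht.
  - destruct t as [|r [|]]; try discriminate. rewrite sum_O. simpl. ring.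
  - destruct t as [|r t]; try discriminate. injection Ht as Ht.
    rewrite sum_n_shift. simpl peval. rewrite (IH t w Ht), <- sum_n_Cmult_l.
    simpl nth. f_equal. simpl; ring. apply sum_n_ext. intros k.
    change (w * (RtoC (nth k t 0%R) * w ^ k) = RtoC (nth k t 0%R) * (w * w ^ k))%C. ring.
Qed.

(** Beyond its head, the formal solution contributes epsb u t(u) with u = epsb z^2; splitting off
    z^2 leaves e^2 t(e z^2). Thus z^(2k) comes only with e^(k+2), which determines the coefficient
    array and the bound m + 2. *)
Lemma real_poly_even_peval (m : nat) (t : list R) : length t = S m ->
  real_poly_even (2 * m) (fun z e => e ^ 2 * peval t (e * z ^ 2))%C.
Proof.
  intros Ht.
  exists (m + 2)%nat, (fun j n => if Nat.even j && (n =? Nat.div2 j + 2)%nat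
                             then nth (Nat.div2 j) t 0 else 0)%bool.
  split.
  - intros j n Hj. apply Nat.odd_spec in Hj. rewrite <- Nat.negb_even in Hj.
    now destruct (Nat.even j).
  - intros z e. rewrite sum_n_even.
    + rewrite (peval_sum_n m t _ Ht).
      rewrite <- sum_n_Cmult_l. apply sum_n_ext_loc. intros k Hk.
      rewrite (sum_n_single _ (k + 2)%nat) by
        (try lia; intros n Hn; rewrite Nat.div2_double, (proj2 (Nat.eqb_neq n (k + 2)) Hn),
           Bool.andb_false_r; ring).
      rewrite Nat.div2_double, Nat.eqb_refl, Nat.even_mul.
      change (e ^ 2 * (RtoC (nth k t 0%R) * (e * z ^ 2) ^ k)
        = RtoC (nth k t 0%R) * z ^ (2 * k) * e ^ (k + 2))%C.
      rewrite Cpow_mult_l, Cpow_mult_r, Cpow_add_r. ring.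
    + intros j Hj. apply Nat.odd_spec in Hj. rewrite <- Nat.negb_even in Hj.
      destruct (Nat.even j); [discriminate|].
      rewrite (sum_n_single _ 0) by (try lia; intros; simpl; ring). simpl. ring.
Qed.

(** The condition on the heads is the static resonance (l+1) a0 (-o) = eta0 a0 l o with o =
    (2l-1)!!, solved by eta0 = -(l+1)/l; a0 q0 is positive. *)
Lemma reduced_poly_solution (l : nat) : (1 <= l)%nat ->
  exists t : list R, length t = l /\
    bigO (S l) (peval (reduced_poly l (- ((INR l + 1) / INR l) :: t))).
Proof.
  intros Hl. assert (Hl1 : 1 <= INR l) by (now apply (le_INR 1)).
  destruct (psi_list_cons l) as [ta Ea]. destruct (chi_list_cons l) as [tb Eb].
  unfold reduced_poly. rewrite Ea, Eb. simpl euler_op.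
  assert (P := odd_fact_pos (l + 1)). assert (P' := odd_fact_pos l).
  apply formal_solution.
  - apply Rgt_not_eq, Rmult_lt_0_compat; [now apply Rinv_0_lt_compat | nra].
  - rewrite plus_INR. simpl INR. field. lra.
Qed.

(** * Explicit coefficients for the dipole and the quadrupole *)

Lemma psi_list_1 : psi_list 1 = [1 / 3; -1 / 30].
Proof.
  unfold psi_list, j_coeff, odd_fact. simpl. repeat (apply f_equal2; [field|]). reflexivity.
Qed.

Lemma chi_list_1 : chi_list 1 = [-1; -1 / 2].
Proof.
  unfold chi_list, cos_list, cos_coeff, odd_fact. simpl.
  repeat (apply f_equal2; [field|]). reflexivity.
Qed.

Lemma psi_list_2 : psi_list 2 = [1 / 15; -1 / 210; 1 / 7560].
Proof.
  unfold psi_list, j_coeff, odd_fact. simpl. repeat (apply f_equal2; [field|]). reflexivity.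
Qed.

Lemma chi_list_2 : chi_list 2 = [-3; -1 / 2; -1 / 8].
Proof.
  unfold chi_list, cos_list, cos_coeff, odd_fact. simpl.
  repeat (apply f_equal2; [field|]). reflexivity.
Qed.

Lemma bigO_peval_id (L : list R) : bigO 0 (peval L).
Proof. apply (bigO_peval L (fun z => z)), bigO_any_0 with 1%nat, bigO_id. Qed.

(** A finite check in rational arithmetic: the two lowest coefficients of the residue vanish, and
    the rest is bounded. *)
Lemma dipole_solution :
  bigO 2 (peval (reduced_poly 1 (- ((INR 1 + 1) / INR 1) :: [- (12 / 5)]))).
Proof.
  unfold reduced_poly, dispersion_poly. rewrite psi_list_1, chi_list_1.
  cbn [padd pmul pcomp map euler_op INR Nat.add].
  do 2 (apply bigO_peval_cons; [field|]).
  apply bigO_peval_id.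
Qed.

Lemma quadrupole_solution :
  bigO 3 (peval (reduced_poly 2 (- ((INR 2 + 1) / INR 2) :: [- (5 / 14); - (65 / 392)]))).
Proof.
  unfold reduced_poly, dispersion_poly. rewrite psi_list_2, chi_list_2.
  cbn [padd pmul pcomp map euler_op INR Nat.add].
  do 3 (apply bigO_peval_cons; [field|]).
  apply bigO_peval_id.
Qed.

Lemma neq_0_of_cut_plane (z : C) : ~ (Im z = 0 /\ Re z <= 0) -> z <> 0%C.
Proof. intros H ->. apply H. simpl. lra. Qed.

(** * The general expansion and its two explicit cases *)

Theorem mainTheorem4 :
  (forall l : nat, (1 <= l)%nat ->
     exists F : C -> C -> C,
       real_poly_even (2 * l - 2) F /\
       forall (epsb : C) (ep : C -> C),
         ~ (Im epsb = 0 /\ Re epsb <= 0) -> 0 <= Im epsb ->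
         plasmonic_singularity l epsb ep ->
         eq_mod_bigO ep
           (fun z : C =>
              - (RtoC ((INR l + 1) / INR l) * epsb)
              + z ^ 2 * F z epsb
              - Ci * z ^ (2 * l + 1) * epsb ^ (l + 1) * Csqrt epsb
                * RtoC ((INR l + 1) / INR l ^ 2)
                * RtoC (1 / INR (double_fact (2 * l - 1)) ^ 2))%C
           (2 * l + 2)) /\
  (forall (epsb : C) (ep : C -> C),
     ~ (Im epsb = 0 /\ Re epsb <= 0) -> 0 <= Im epsb ->
     plasmonic_singularity 1 epsb ep ->
     eq_mod_bigO ep
       (fun z : C =>
          - (2 * epsb)
          - RtoC (12 / 5) * epsb ^ 2 * z ^ 2
          - 2 * Ci * epsb ^ 2 * Csqrt epsb * z ^ 3)%C
       4) /\
  (forall (epsb : C) (ep : C -> C),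
     ~ (Im epsb = 0 /\ Re epsb <= 0) -> 0 <= Im epsb ->
     plasmonic_singularity 2 epsb ep ->
     eq_mod_bigO ep
       (fun z : C =>
          - (RtoC (3 / 2) * epsb)
          - RtoC (5 / 14) * epsb ^ 2 * z ^ 2
          - RtoC (65 / 392) * epsb ^ 3 * z ^ 4
          - Ci / 12 * epsb ^ 3 * Csqrt epsb * z ^ 5)%C
       6).
Proof.
  split; [|split].
  - intros l Hl. destruct (reduced_poly_solution l Hl) as (t & Ht & Hsol).
    exists (fun z e => e ^ 2 * peval t (e * z ^ 2))%C. split.
    + replace (2 * l - 2)%nat with (2 * (l - 1))%nat by lia.
      apply real_poly_even_peval. lia.
    + intros epsb ep Hcut _ Hep. apply eq_mod_bigO_iff.
      eapply bigO_ext;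
        [|exact (plasmonic_expansion l t epsb ep Hl Hsol (neq_0_of_cut_plane _ Hcut) Hep)].
      intros z _. cbv beta. simpl peval. fold (odd_fact l). rewrite RtoC_opp. ring.
  - intros epsb ep Hcut _ Hep. apply eq_mod_bigO_iff.
    eapply bigO_ext;
      [|exact (plasmonic_expansion 1 _ epsb ep (le_n 1) dipole_solution
                 (neq_0_of_cut_plane _ Hcut) Hep)].
    intros z _. cbv beta. simpl peval. unfold odd_fact. simpl double_fact. simpl INR.
    replace ((1 + 1) / 1) with 2 by field.
    replace ((1 + 1) / 1 ^ 2) with 2 by field.
    replace (1 / 1 ^ 2) with 1 by field.
    rewrite !RtoC_opp. simpl Cpow. ring.
  - intros epsb ep Hcut _ Hep. apply eq_mod_bigO_iff.
    eapply bigO_ext;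
      [|exact (plasmonic_expansion 2 _ epsb ep (le_S _ _ (le_n 1)) quadrupole_solution
                 (neq_0_of_cut_plane _ Hcut) Hep)].
    intros z _. cbv beta. simpl peval. unfold odd_fact. simpl double_fact. simpl INR.
    replace ((1 + 1 + 1) / (1 + 1)) with (3 / 2) by field.
    replace ((1 + 1 + 1) / (1 + 1) ^ 2) with (3 / 4) by field.
    replace (1 / (1 + 1 + 1) ^ 2) with (1 / 9) by field.
    (* For l = 2 the prefactor is (l+1)/l^2 = 3/4 times 1/(3!!)^2 = 1/9. *)
    assert (E : (/ 12 = RtoC (3 / 4) * RtoC (1 / 9))%C).
    { rewrite <- RtoC_mult, <- RtoC_inv by lra. f_equal. field. }
    rewrite !RtoC_opp. unfold Cdiv. rewrite E. simpl Cpow. ring.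
Qed.
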